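(* Let $A$ be an algebra generated by a linear subspace $V\subseteq A$, let $K\subseteq X(A)$ be closed, let $q$ be a Hilbertian seminorm on $V$ such that $M:=\{\alpha\in K:\alpha\restriction_V\text{ is }q\text{-continuous}\}\neq\emptyset$, and let $J:=\{\langle W\rangle: W\text{ finite dimensional subspace of }V\}$. Let $L:A\to\mathbb{R}$ be a linear functional with $L(1)=1$ and let $Q$ be a quadratic module in $A$ such that $K=K_Q$. Then the following are equivalent: (i) there exists a representing Radon measure $\nu$ for $L$ on $X(A)$ with $\nu(X(A)\setminus M)=0$; (ii) there exist a Hilbertian seminorm $p$ on $V$ with $\mathrm{tr}(p/q)<\infty$ and, for each $S\in J$, a representing Radon measure $\nu_S$ for $L\restriction_S$ on $X(S)$ with support contained in $K_{Q\cap S}$ such that the family $\{\nu_S:S\in J\}$ is $p$-concentrated.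
   Context: Algebras are unital commutative $\mathbb{R}$-algebras (not necessarily finitely generated). For an algebra $A$, the character space $X(A)$ is the set of all $\mathbb{R}$-algebra homomorphisms $A\to\mathbb{R}$; it is assumed non-empty and carries the weakest topology making all maps $\hat a:X(A)\to\mathbb{R}$, $\hat a(\alpha)=\alpha(a)$ ($a\in A$), continuous, and its Borel $\sigma$-algebra. $A$ is generated by a linear subspace $V$ if $V$ contains a set of generators of $A$; $\langle W\rangle$ is the subalgebra of $A$ generated by $W$. A Radon measure is a non-negative Borel measure that is locally finite and inner regular with respect to compact sets; its support is the smallest closed set with null complement. A representing Radon measure for a linear functional $L$ on $A$ is a Radon measure $\nu$ on $X(A)$ with $L(a)=\int_{X(A)}\hat a\,d\nu$ for all $a\in A$ (analogously for $S\in J$ and $X(S)$). A quadratic module in $A$ is a subset $Q\subseteq A$ with $1\in Q$, $Q+Q\subseteq Q$ and $a^2Q\subseteq Q$ for all $a\in A$; $K_Q:=\{\alpha\in X(A):\alpha(a)\ge0\ \forall a\in Q\}$. For a subalgebra $S$, $K_{Q\cap S}:=\{\alpha\in X(S):\alpha(a)\ge 0\ \forall a\in Q\cap S\}$. A seminorm $p$ on a real vector space is Hilbertian if $p(v)=\sqrt{\langle v,v\rangle_p}$ for a (necessarily unique) symmetric positive semidefinite bilinear form $\langle\cdot,\cdot\rangle_p$. A linear functional $l$ on $V$ is $q$-continuous if $|l(v)|\le Cq(v)$ for all $v\in V$, for some $C>0$. For Hilbertian seminorms $p,q$ on $V$, $\mathrm{tr}(p/q):=\sup_E\sum_{e\in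 E}p(e)^2$ over all finite $q$-orthonormal subsets $E\subseteq V$ if $\ker(q)\subseteq\ker(p)$, and $\mathrm{tr}(p/q):=\infty$ otherwise. With $B_\delta(p):=\{v\in V:p(v)\le\delta\}$, a family of Radon measures $\nu_S$ on $X(S)$, $S\in J$, is $p$-concentrated if for every $\varepsilon>0$ there is $\delta>0$ such that $\nu_S(\{\alpha\in X(S):|\alpha(a)|\ge 1\})\le\varepsilon$ for all $S\in J$ and all $a\in B_\delta(p)\cap S$. *)

(* Defs.v *)
From HB Require Import structures.
From mathcomp Require Import all_boot all_order all_algebra finmap.
From mathcomp Require Import all_classical all_reals all_analysis.

Set Implicit Arguments.
Unset Strict Implicit.
Unset Printing Implicit Defensive.

Import Order.TTheory GRing.Theory Num.Theory.
Import numFieldNormedType.Exports.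

Local Open Scope classical_set_scope.
Local Open Scope ring_scope.

(* Algebras whose character space is not empty.  Measurable types are pointed
   in MathComp-Analysis, so this assumption has to be part of the structure;
   the chosen point plays no other role. *)
HB.mixin Record HasCharacter (R : realType) A of GRing.ComAlgebra R A := {
  character_inhabited : inhabited {lrmorphism A -> R | *%R}
}.

#[short(type="charAlgType")]
HB.structure Definition CharAlgebra (R : realType) :=
  {A of GRing.ComAlgebra R A & HasCharacter R A}.

Definition charSpace (R : realType) (A : charAlgType R) : Type :=
  {lrmorphism A -> R | *%R}.

Definition char_fun (R : realType) (A : charAlgType R) (alpha : charSpace A) :
  A -> R := (alpha : {lrmorphism A -> R | *%R}).
Coercion char_fun : charSpace >-> Funclass.

Definition hat (R : realType) (A : charAlgType R) (a : A) : charSpace A -> R :=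
  fun alpha => alpha a.

HB.instance Definition _ (R : realType) (A : charAlgType R) :=
  gen_eqMixin (charSpace A).
HB.instance Definition _ (R : realType) (A : charAlgType R) :=
  gen_choiceMixin (charSpace A).

Lemma charSpace_nonempty (R : realType) (A : charAlgType R) :
  exists alpha : charSpace A, True.
Proof. by case: (@character_inhabited R A) => alpha; exists alpha. Qed.

HB.instance Definition _ (R : realType) (A : charAlgType R) :=
  isPointed.Build (charSpace A) (sval (cid (charSpace_nonempty A))).

(* The weakest topology making every [hat a] continuous. *)
HB.instance Definition _ (R : realType) (A : charAlgType R) :=
  Topological.copy (charSpace A)
    (sup_topology (fun a : A => Topological.class (initial_topology (hat a)))).

HB.instance Definition _ (R : realType) (A : charAlgType R) :=
  @isMeasurable.Build (sigma_display (@open (charSpace A))) (charSpace A)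
    <<s @open (charSpace A) >> (@sigma_algebra0 _ setT _)
    (@sigma_algebraC _ _) (@sigma_algebra_bigcup _ setT _).

Lemma charP (R : realType) (A : charAlgType R) (alpha beta : charSpace A) :
  (forall a, alpha a = beta a) -> alpha = beta.
Proof.
case: alpha beta => [f fP] [g gP] /= fg.
have {}fg : f = g by apply/funext => a; exact: fg.
case: _ / fg in gP *; congr GRing.LRMorphism.Pack.
case: fP gP => [[?] [?] [?]] [[?] [?] [?]].
by congr GRing.LRMorphism.Class; congr (_ _); exact: Prop_irrelevance.
Qed.

Lemma hat_continuous (R : realType) (A : charAlgType R) (a : A) :
  continuous (hat a).
Proof.
move=> alpha.
have h := (@cvg_sup _ _ _ (nbhs alpha) alpha _).1 (@cvg_id _ (nbhs alpha)) a.
move=> U /(@initial_continuous _ _ (hat a) alpha); exact: h.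
Qed.

Lemma charSpace_hausdorff (R : realType) (A : charAlgType R) :
  hausdorff_space (charSpace A).
Proof.
move=> alpha beta ab; apply: charP => a; apply: (@Rhausdorff R) => U W aU bW.
have [c [cU cW]] := ab _ _ (hat_continuous aU) (hat_continuous bW).
by exists (c a).
Qed.

Definition subspace_type (R : realType) (A : lmodType R) (V : submodClosed A) :=
  {v : A | v \in V}.
HB.instance Definition _ (R : realType) (A : lmodType R) (V : submodClosed A) :=
  SubChoice.on (subspace_type V).
HB.instance Definition _ (R : realType) (A : lmodType R) (V : submodClosed A) :=
  [SubChoice_isSubLmodule of subspace_type V by <:].

Definition subalg_type (R : realType) (A : comAlgType R) (S : subalgClosed A) :=
  {a : A | a \in S}.
HB.instance Definition _ (R : realType) (A : comAlgType R)
  (S : subalgClosed A) := SubChoice.on (subalg_type S).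
HB.instance Definition _ (R : realType) (A : comAlgType R)
  (S : subalgClosed A) := [SubChoice_isSubAlgebra of subalg_type S by <:].
HB.instance Definition _ (R : realType) (A : comAlgType R)
  (S : subalgClosed A) :=
  [SubNzRing_isSubComNzRing of subalg_type S by <:].

Definition char_restr_fun (R : realType) (A : charAlgType R)
  (S : subalgClosed A) (alpha : charSpace A) : subalg_type S -> R :=
  fun s => alpha (val s).

Section CharRestriction.
Context (R : realType) (A : charAlgType R) (S : subalgClosed A).
Context (alpha : charSpace A).

Lemma char_restr_linear : linear_for *%R (char_restr_fun (S := S) alpha).
Proof.
by move=> c s t; rewrite /char_restr_fun linearP /= /char_fun linearP.
Qed.

Lemma char_restr_monoid_morphism :
  GRing.monoid_morphism (char_restr_fun (S := S) alpha).
Proof.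
by split=> [|s t]; rewrite /char_restr_fun /char_fun ?rmorphM ?rmorph1.
Qed.

HB.instance Definition _ := GRing.isLinear.Build R (subalg_type S) R *%R
  (char_restr_fun (S := S) alpha) char_restr_linear.
HB.instance Definition _ := GRing.isMonoidMorphism.Build (subalg_type S) R
  (char_restr_fun (S := S) alpha) char_restr_monoid_morphism.
End CharRestriction.

Lemma subalg_character (R : realType) (A : charAlgType R)
  (S : subalgClosed A) : inhabited {lrmorphism subalg_type S -> R | *%R}.
Proof.
have [alpha] := @character_inhabited R A; constructor.
exact: (char_restr_fun (S := S) (alpha : charSpace A)).
Qed.
HB.instance Definition _ (R : realType) (A : charAlgType R)
  (S : subalgClosed A) :=
  HasCharacter.Build R (subalg_type S) (subalg_character S).

Definition gen_subalg (R : realType) (A : comAlgType R) (G : set A) :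
    {pred A} :=
  fun a => `[< forall S : subalgClosed A,
                 (forall g, G g -> g \in S) -> a \in S >].

Lemma gen_subalg_closed (R : realType) (A : comAlgType R) (G : set A) :
  GRing.subsemialg_closed (gen_subalg G).
Proof.
have inE' a : a \in gen_subalg G <->
    forall S : subalgClosed A, (forall g, G g -> g \in S) -> a \in S.
  by split=> [/asboolP|h]; [exact | exact/asboolP].
split; first by apply/inE' => S _; exact: rpred1.
- split=> [|u v /inE' uS /inE' vS]; apply/inE' => S GS; first exact: rpred0.
  by apply: rpredD; [exact: uS|exact: vS].
- by move=> c u /inE' uS; apply/inE' => S GS; apply: rpredZ; exact: uS.
- by move=> u v /inE' uS /inE' vS; apply/inE' => S GS;
    apply: rpredM; [exact: uS|exact: vS].
Qed.
HB.instance Definition _ (R : realType) (A : comAlgType R) (G : set A) :=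
  GRing.isSubalgClosed.Build R A (gen_subalg G) (gen_subalg_closed G).

Definition generated_by (R : realType) (A : comAlgType R)
    (V : submodClosed A) : Prop :=
  exists2 G : set A, (forall g, G g -> g \in V) &
                     (forall a, a \in gen_subalg G).

Definition finite_dim (R : realType) (E : lmodType R) (W : submodClosed E) :
    Prop :=
  exists n (e : 'I_n -> E), (forall i, e i \in W) /\
    forall w, w \in W -> exists c : 'I_n -> R, w = \sum_(i < n) c i *: e i.

Definition fin_gen_subalgs (R : realType) (A : comAlgType R)
    (V : submodClosed A) : set (subalgClosed A) :=
  [set S | exists W : submodClosed A,
     [/\ {subset W <= V}, finite_dim W & S =i gen_subalg [set` W]]].

Definition quadratic_module (R : realType) (A : comAlgType R) (Q : set A) :
    Prop :=
  [/\ Q 1, (forall a b, Q a -> Q b -> Q (a + b)) &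
      (forall a b, Q b -> Q (a ^+ 2 * b))].

Definition nonneg_chars (R : realType) (A : charAlgType R) (Q : set A) :
    set (charSpace A) :=
  [set alpha | forall a, Q a -> 0 <= alpha a].

Definition seminorm (R : realType) (E : lmodType R) (p : E -> R) : Prop :=
  (forall u v, p (u + v) <= p u + p v) /\
  (forall c v, p (c *: v) = `|c| * p v).

Record hilbertian_seminorm (R : realType) (E : lmodType R) :=
  HilbertianSeminorm {
    hnorm :> E -> R;
    hnorm_seminorm : seminorm hnorm;
    hform : {biscalar E};
    hform_sym : forall u v, hform u v = hform v u;
    hform_ge0 : forall v, 0 <= hform v v;
    hnormE : forall v, hnorm v = Num.sqrt (hform v v)
  }.

Definition seminorm_continuous (R : realType) (E : lmodType R) (q : E -> R)
    (l : E -> R) : Prop :=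
  exists2 C, 0 < C & forall v, `|l v| <= C * q v.

Definition q_orthonormal (R : realType) (E : lmodType R)
    (q : hilbertian_seminorm E) (F : {fset E}) : Prop :=
  {in F &, forall e f, hform q e f = (e == f)%:R}.

Definition seminorm_trace (R : realType) (E : lmodType R)
    (p q : hilbertian_seminorm E) : \bar R :=
  if `[< forall v, q v = 0 -> p v = 0 >]
  then ereal_sup [set (\sum_(e <- F) p e ^+ 2)%:E | F in q_orthonormal q]
  else +oo%E.

Section Measures.
Context (R : realType) (A : charAlgType R).
Implicit Type mu : {measure set (charSpace A) -> \bar R}.

(* Compact sets are Borel here, since the character space is Hausdorff. *)
Definition radon mu : Prop :=
  (forall alpha, exists U : set (charSpace A),
     [/\ open U, U alpha & (mu U < +oo)%E]) /\
  (forall B, measurable B ->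
     mu B = ereal_sup [set mu C | C in [set C | compact C /\ C `<=` B]]).

Definition measure_support mu : set (charSpace A) :=
  \bigcap_(C in [set C | closed C /\ mu (~` C) = 0%E]) C.

Definition representing_radon (l : A -> R) mu : Prop :=
  radon mu /\
  forall a, mu.-integrable setT (EFin \o hat a) /\
            ((l a)%:E = \int[mu]_alpha (hat a alpha)%:E)%E.

End Measures.

Definition continuous_chars (R : realType) (A : charAlgType R)
    (V : submodClosed A) (K : set (charSpace A))
    (q : hilbertian_seminorm (subspace_type V)) : set (charSpace A) :=
  [set alpha | K alpha /\
     seminorm_continuous q (fun v : subspace_type V => alpha (val v))].

Definition semiball (R : realType) (E : lmodType R) (p : E -> R) (delta : R) :
    set E :=
  [set v | p v <= delta].

(* The family is indexed by all subalgebras for convenience; its values outside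
   J are never used. *)
Definition concentrated (R : realType) (A : charAlgType R)
    (V : submodClosed A) (p : hilbertian_seminorm (subspace_type V))
    (J : set (subalgClosed A))
    (nu : forall S : subalgClosed A,
       {measure set (charSpace (subalg_type S)) -> \bar R}) : Prop :=
  forall eps : R, 0 < eps -> exists2 delta : R, 0 < delta &
    forall S, J S ->
    forall (v : subspace_type V) (s : subalg_type S),
      semiball p delta v -> val v = val s ->
      (nu S [set alpha | (1 <= `|alpha s|)%R] <= eps%:E)%E.

(* Main.v *)
From HB Require Import structures.
Require Import Defs.
From mathcomp Require Import all_boot all_order all_algebra finmap.
From mathcomp Require Import all_classical all_reals all_analysis.
From mathcomp Require Import measurable_realfun lra.

Set Implicit Arguments.
Unset Strict Implicit.
Unset Printing Implicit Defensive.

Import Order.TTheory GRing.Theory Num.Theory.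
Import numFieldNormedType.Exports.

Local Open Scope classical_set_scope.
Local Open Scope ring_scope.

(** Why the equivalence holds.

    From the family to a measure on X(A).  The measures nu_S need not be
    compatible under restriction, so they form no projective system.  They are
    made compatible by a limit along an ultrafilter on the finite lists F of
    vectors of V, containing every set of lists that include a given one.  A
    character of the algebra generated by F, extended by zero, is a function
    from A to the reals; every open set W of functions thus has a limit mass.
    The infimum of this mass over the neighbourhoods W of a compact set of
    characters of A is a content, and a content extends to a Radon measure
    ([content_radon], [limit_measure]).

    No mass escapes from the characters bounded by n times q on V.  On finitely
    many q-orthonormal vectors this is the inequality of Sazonov
    ([sazonov_inequality]): for a character alpha and random signs r, the number
    alpha (\sum r_i e_i) is at least a fixed fraction of the norm of
    (alpha (e_i))_i with probability at least 1/6, whereas the mean of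
    p (\sum r_i e_i)^2 is \sum p (e_i)^2, hence at most tr(p/q).  Concentration
    with respect to p then bounds the mass of the characters that are large on
    the e_i, uniformly in the subalgebra ([tight_bound]).  The set of characters
    in K bounded by n times q is compact, and ultralimits of such characters
    of the subalgebras lie in it ([ultralimit_character]), so the limit measure
    gives it almost full mass as well.

    For the moments, masses of open sets can only drop when passing to the
    limit measure mu, which yields \int b^2 d mu <= L (b^2) for every b in A.
    For b = 1 + s a with s an arbitrary real number, the linear term in s must
    agree on both sides: \int a d mu = L a ([moments_of_second_moments]).

    From a measure to a family.  The measures nu_S are the images of nu under
    restriction of characters.  With |alpha| the norm of alpha as a functional
    on (V, q), the weight w = 1 / (1 + |alpha|^2) is positive exactly on the
    q-continuous characters, and p (v)^2 = \int w (alpha) alpha (v)^2 d nu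
    defines a Hilbertian seminorm.  By Bessel, w (alpha) \sum alpha (e_i)^2 <= 1
    on every q-orthonormal family, so tr(p/q) <= 1 ([dominating_seminorm]), and
    p controls alpha (v) off the set where w is small, which has small measure
    ([restr_measure_concentrated]). *)

(** * Radon measures from contents on compact sets *)

(** A space of characters is in general neither compact nor locally compact, so
    the separation is carried out by hand: first a point from a compact set, then
    two compact sets. *)
Lemma compact_disjoint_open (T : topologicalType) (A B : set T) :
  hausdorff_space T -> compact A -> compact B -> A `&` B = set0 ->
  exists U W : set T,
    [/\ open U, open W, A `<=` U, B `<=` W & U `&` W = set0].
Proof.
move=> hT cA cB AB0.
have sep (C : set T) y : compact C -> ~ C y ->
    exists2 U, nbhs y U & C `<=` ~` closure U.
  move=> cC nCy.
  have : \forall U \near powerset_filter_from (nbhs y), C `<=` ~` closure U.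
    apply: (compact_near_coveringP C).1 => // x Cx.
    have xy : x != y by apply/eqP => xy; apply: nCy; rewrite -xy.
    have := hT; rewrite open_hausdorff => /(_ x y xy).
    move=> [[W U]/= [Wx Uy] [oW oU WU0]].
    exists (W, [set U' | nbhs y U' /\ U' `<=` U]).
      split => /=; first by exact: open_nbhs_nbhs (conj oW (set_mem Wx)).
      apply: powerset_filter_fromP.
      exact: open_nbhs_nbhs (conj oU (set_mem Uy)).
    move=> [x' U']/= [Wx' [nU' U'U]] /(_ W (open_nbhs_nbhs (conj oW Wx'))).
    move=> [z [U'z Wz]]; suff : set0 z by [].
    by rewrite -(eqP WU0); split=> //; exact: U'U.
  by move=> [M [MF _ [U MU]] /(_ U MU) CU]; exists U => //; exact: MF.
have [A0|/set0P/set_nbhs_pfilter pA] := eqVneq A set0.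
  by exists set0, setT; split=> //;
    [exact: open0|exact: openT|rewrite A0|rewrite set0I].
have : \forall W \near powerset_filter_from (set_nbhs A),
    B `<=` ~` closure W.
  apply: (compact_near_coveringP B).1 => // y By.
  have nAy : ~ A y by move=> Ay; suff : set0 y by []; rewrite -AB0.
  have [U nU AU] := sep A y cA nAy.
  exists (U^°, [set W' | set_nbhs A W' /\ W' `<=` ~` closure U]).
    split => /=; first exact: nbhs_interior.
    apply: powerset_filter_fromP => x Ax.
    apply: open_nbhs_nbhs; split; last exact: AU.
    exact/closed_openC/closed_closure.
  move=> [y' W']/= [Uy' [nW' W'U]] /(_ U Uy').
  by move=> [z [W'z Uz]]; apply: (W'U _ W'z); exact: subset_closure.
move=> [M [MF _ [W MW]] /(_ W MW) BW]; have nW := MF _ MW.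
exists W^°, (~` closure W); split=> //.
- exact: open_interior.
- by apply: closed_openC; exact: closed_closure.
- by rewrite -subset0 => x [/interior_subset Wx]; apply; exact: subset_closure.
Qed.

(** A content on the compact sets that is subadditive, and additive on disjoint
    compact sets, extends to a measure on the Borel sets: [inner] extends it to
    the open sets from inside, [outer] to all sets from outside, and every open
    set is measurable in the sense of Caratheodory.  Compactness enters twice:
    a compact subset of a countable union of open sets splits into finitely
    many compact pieces ([compact_splitU]), and removing a compact set from an
    open set leaves an open set. *)
Section content_extension.
Context (R : realType) (T : topologicalType) (hT : hausdorff_space T).
Variables (lam : set T -> R) (M : R).
Hypothesis lam_ge0 : forall C, compact C -> 0 <= lam C.
Hypothesis lamU_le : forall C D, compact C -> compact D ->
  lam (C `|` D) <= lam C + lam D.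
Hypothesis lamU : forall C D, compact C -> compact D -> C `&` D = set0 ->
  lam C + lam D <= lam (C `|` D).
Hypothesis lam_bounded : forall C, compact C -> lam C <= M.

Local Open Scope ereal_scope.

Let inner (U : set T) : \bar R :=
  ereal_sup [set (lam C)%:E | C in [set C | compact C /\ C `<=` U]].
Let outer (E : set T) : \bar R :=
  ereal_inf [set inner U | U in [set U | open U /\ E `<=` U]].

Let inner_lam C U : compact C -> C `<=` U -> (lam C)%:E <= inner U.
Proof. by move=> cC CU; apply: ereal_sup_ubound; exists C. Qed.

Let inner_ub U x : (forall C, compact C -> C `<=` U -> (lam C)%:E <= x) ->
  inner U <= x.
Proof. by move=> h; apply: ge_ereal_sup => _ [C [cC CU] <-]; exact: h. Qed.

Let inner_le U W : U `<=` W -> inner U <= inner W.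
Proof.
move=> UW; apply: inner_ub => C cC CU; apply: inner_lam => //.
exact: subset_trans UW.
Qed.

Let inner_ge0 U : 0 <= inner U.
Proof.
apply: (le_trans _ (inner_lam compact0 _)) => //.
by rewrite lee_fin lam_ge0//; exact: compact0.
Qed.

Let inner_fin U : inner U \is a fin_num.
Proof.
rewrite ge0_fin_numE// (@le_lt_trans _ _ M%:E) ?ltry//.
by apply: inner_ub => C cC _; rewrite lee_fin lam_bounded.
Qed.

Let compact_splitU C U W : compact C -> open U -> open W -> C `<=` U `|` W ->
  exists D E : set T,
    [/\ compact D, compact E, C = D `|` E, D `<=` U & E `<=` W].
Proof.
move=> cC oU oW CUW.
have cD (O : set T) : open O -> compact (C `\` O).
  by move=> oO; apply: compact_closedI => //; exact: open_closedC.
have [|O [P [oO oP CO CP OP0]]] :=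
    compact_disjoint_open hT (cD U oU) (cD W oW).
  by rewrite -subset0 => x [[Cx nUx] [_ nWx]]; case: (CUW x Cx).
exists (C `\` O), (C `\` P); split; [exact: cD|exact: cD| | |].
- rewrite -setDIr OP0 setD0//.
- by move=> x [Cx nOx]; apply: contrapT => nUx; exact/nOx/CO.
- by move=> x [Cx nPx]; apply: contrapT => nWx; exact/nPx/CP.
Qed.

Let lam_bigcup (U : (set T)^nat) n C : (forall i, open (U i)) ->
  compact C -> C `<=` \bigcup_(i < n) U i ->
  (lam C)%:E <= \sum_(0 <= i < n) inner (U i).
Proof.
move=> oU; elim: n C => [|n IHn] C cC CU.
  rewrite big_geq// lee_fin.
  have -> : C = set0 by rewrite -subset0 => x /CU [].
  have := lamU compact0 compact0 (setI0 _).
  by rewrite setU0 -lerBrDr subrr.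
have [|||D [E [cD cE CDE DU EU]]] :=
    @compact_splitU C (\bigcup_(i < n) U i) (U n) cC.
- exact: bigcup_open.
- exact: oU.
- move=> x /CU [i /=]; rewrite ltnS leq_eqVlt => /orP[/eqP ->|lt_in] Uix.
    by right.
  by left; exists i.
rewrite CDE big_nat_recr//=.
apply: (@le_trans _ _ ((lam D)%:E + (lam E)%:E)).
  by rewrite -EFinD lee_fin lamU_le.
by apply: leeD; [exact: IHn|exact: inner_lam].
Qed.

Let inner_bigcup (U : (set T)^nat) : (forall i, open (U i)) ->
  inner (\bigcup_i U i) <= \sum_(i <oo) inner (U i).
Proof.
move=> oU; apply: inner_ub => C cC CU.
have : \forall n \near \oo, C `<=` \bigcup_(i < n) U i.
  apply: (compact_near_coveringP C).1 => // x /CU [i _ Uix].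
  exists (U i, [set n | (i < n)%N]).
    split => /=; first exact: open_nbhs_nbhs.
    by exists i.+1.
  by move=> [y n]/= [Uiy lt_in]; exists i.
move=> [n _ /(_ n (leqnn n)) Cn].
apply: le_trans (lam_bigcup oU cC Cn) _.
by apply: nneseries_lim_ge => i _ _; exact: inner_ge0.
Qed.

Let outer_open U : open U -> outer U = inner U.
Proof.
move=> oU; apply/eqP; rewrite eq_le; apply/andP; split.
  by apply: ereal_inf_lbound; exists U => //; split.
by apply: le_ereal_inf_tmp => _ [W [_ UW] <-]; exact: inner_le.
Qed.

Let outer_ge0 E : 0 <= outer E.
Proof. by apply: le_ereal_inf_tmp => _ [W _ <-]; exact: inner_ge0. Qed.

Let outer_fin E : outer E \is a fin_num.
Proof.
rewrite ge0_fin_numE//; apply: (@le_lt_trans _ _ (inner setT)).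
  by apply: ereal_inf_lbound; exists setT => //; split => //; exact: openT.
by rewrite -ge0_fin_numE.
Qed.

Let outer_le : {homo outer : E F / E `<=` F >-> E <= F}.
Proof.
move=> E F EF; apply: le_ereal_inf_tmp => _ [W [oW FW] <-].
by apply: ereal_inf_lbound; exists W => //; split=> //; exact: subset_trans FW.
Qed.

Let outer_set0 : outer set0 = 0.
Proof.
rewrite outer_open; last exact: open0.
apply/eqP; rewrite eq_le inner_ge0 andbT; apply: inner_ub => C cC C0.
have := lam_bigcup (U := fun=> set0) (n := 0%N) (fun=> open0) cC.
by rewrite big_geq//; apply; rewrite bigcup_mkord big_ord0.
Qed.

Let outer_sigma_subadditive : sigma_subadditive outer.
Proof.
move=> F; apply/lee_addgt0Pr => e e0.
have h n : exists U, [/\ open U, F n `<=` U &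
    inner U <= outer (F n) + (e / (2 ^ n.+1)%:R)%:E].
  have en0 : (0 < e / (2 ^ n.+1)%:R)%R by rewrite divr_gt0// ltr0n expn_gt0.
  have [_ [U [oU FU] <-] /ltW Ule] := lb_ereal_inf_adherent en0 (outer_fin (F n)).
  by exists U.
pose U n := sval (cid (h n)).
have oU n : open (U n) by rewrite /U; case: cid => ? [].
have FU n : F n `<=` U n by rewrite /U; case: cid => ? [].
apply: (@le_trans _ _ (inner (\bigcup_i U i))).
  apply: ereal_inf_lbound; exists (\bigcup_i U i) => //; split.
    exact: bigcup_open.
  exact: subset_bigcup.
apply: le_trans (inner_bigcup oU) _.
apply: le_trans (epsilon_trick xpredT _ (ltW e0)); last by [].
apply: lee_nneseries => [i _ _|i _]; first exact: inner_ge0.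
by rewrite /U; case: cid => ? [].
Qed.

HB.instance Definition _ := isOuterMeasure.Build R T outer
  outer_set0 outer_ge0 outer_le outer_sigma_subadditive.

(** Approximate G `&` U from inside by a compact set C; the complement of C in
    G is open, contains G `\` U, and any compact set inside it is disjoint from
    C, so its content adds up with that of C. *)
Let open_caratheodory U : open U ->
  caratheodory_measurable outer U.
Proof.
move=> oU; apply: (@le_caratheodory_measurable R T outer) => X.
apply: le_ereal_inf_tmp => _ [G [oG XG] <-].
apply: (@le_trans _ _ (inner (G `&` U) + outer (G `\` U))).
  apply: leeD; last by apply: outer_le => x [/XG].
  rewrite -outer_open; last exact: openI.
  by apply: outer_le => x [/XG].
rewrite -leeBrDr//; apply: inner_ub => C cC CO; rewrite leeBrDr//.
apply: (@le_trans _ _ ((lam C)%:E + inner (G `\` C))).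
  apply: leeD => //; rewrite -outer_open; last first.
    by apply: openI => //; apply: closed_openC; exact: compact_closed.
  by apply: outer_le => x [Ox nUx]; split=> // /CO[].
rewrite addeC -leeBrDr//; apply: inner_ub => D cD DO; rewrite leeBrDr//.
rewrite addeC -EFinD.
apply: (@le_trans _ _ (lam (C `|` D))%:E).
  rewrite lee_fin lamU//.
  by rewrite -subset0 => x [Cx /DO[]].
apply: inner_lam; first exact: compactU.
by move=> x [/CO[]|/DO[]].
Qed.

(** The last clause is outer regularity, the source of inner regularity of the
    resulting measure. *)
Lemma content_outer_measure : exists mu : {outer_measure set T -> \bar R},
  [/\ forall U, open U -> caratheodory_measurable mu U,
      forall U, open U -> mu U =
        ereal_sup [set (lam C)%:E | C in [set C | compact C /\ C `<=` U]],
      forall C, compact C -> (lam C)%:E <= mu C &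
      forall E, mu E = ereal_inf [set mu U | U in [set U | open U /\ E `<=` U]]].
Proof.
exists outer; split.
- exact: open_caratheodory.
- exact: outer_open.
- move=> C cC; apply: le_ereal_inf_tmp => _ [W [_ CW] <-].
  exact: inner_lam.
- move=> E; congr ereal_inf; apply/seteqP; split=> _ [U [oU EU] <-];
    exists U => //; [exact: outer_open | exact/esym/outer_open].
Qed.

End content_extension.

(** * Measurability on the space of characters *)
Section superlevel_sets.
Context d (T : measurableType d) (R : realType) (f : T -> R).
Hypothesis mf : measurable_fun setT f.

Lemma measurable_superlevel_gt c : measurable [set x | c < f x].
Proof.
rewrite -[X in measurable X]setTI -preimage_itvoy.
exact: mf measurableT _ (measurable_itv _).
Qed.

Lemma measurable_superlevel_ge c : measurable [set x | c <= f x].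
Proof.
rewrite -[X in measurable X]setTI -preimage_itvcy.
exact: mf measurableT _ (measurable_itv _).
Qed.

End superlevel_sets.

(** The measure structure of an image measure depends on the measurability of
    the map; packing it with that proof makes it usable as a term. *)
Definition pushforward_measure d d' (T1 : measurableType d)
    (T2 : measurableType d') (R : realType) (m : {measure set T1 -> \bar R})
    (f : T1 -> T2) (mf : measurable_fun setT f) : {measure set T2 -> \bar R} :=
  measure_function_pushforward__canonical__measure_function_Measure m mf.

Section charSpace_measurable.
Context (R : realType) (A : charAlgType R).

Lemma open_charSpace_measurable (U : set (charSpace A)) : open U -> measurable U.
Proof. by move=> oU; exact: sub_sigma_algebra. Qed.

Lemma closed_charSpace_measurable (U : set (charSpace A)) :
  closed U -> measurable U.
Proof.
move=> cU; rewrite -(setCK U); apply: measurableC.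
by apply: open_charSpace_measurable; exact: closed_openC.
Qed.

Lemma compact_charSpace_measurable (U : set (charSpace A)) :
  compact U -> measurable U.
Proof.
move=> cU; apply: closed_charSpace_measurable.
exact: compact_closed (@charSpace_hausdorff R A) cU.
Qed.

Lemma continuous_charSpace_measurable (B : charAlgType R)
    (f : charSpace A -> charSpace B) : continuous f -> measurable_fun setT f.
Proof.
move=> cf; apply: (measurability (@open (charSpace B))) => //.
move=> _ [U oU <-]; rewrite setTI; apply: open_charSpace_measurable.
by apply: open_comp => // x _; exact: cf.
Qed.

(** The Borel sets of X(A) are generated by all open sets, including
    uncountable unions of cylinders, so upper semicontinuity is enough; an
    infimum of uncountably many continuous functions is covered. *)
Lemma upper_semicontinuous_charSpace_measurable (f : charSpace A -> R) :
  (forall c, open [set x | f x < c]) -> measurable_fun setT f.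
Proof.
move=> fo; apply: (measurability _ (RGenInftyO.measurableE R)).
move=> _ [_ [c ->] <-]; rewrite setTI preimage_itvNyo.
by apply: open_charSpace_measurable; exact: fo.
Qed.

Lemma continuous_real_measurable (f : charSpace A -> R) :
  continuous f -> measurable_fun setT f.
Proof.
move=> cf; apply: upper_semicontinuous_charSpace_measurable => c.
rewrite -preimage_itvNyo; apply: open_comp => [x _|]; first exact: cf.
exact: lray_open.
Qed.

Lemma hat_measurable (a : A) : measurable_fun setT (hat a).
Proof. apply: continuous_real_measurable; exact: hat_continuous. Qed.

Lemma measurable_hat_norm_ge (a : A) c :
  measurable [set alpha : charSpace A | c <= `|alpha a|].
Proof.
by apply: measurable_superlevel_ge; apply: measurableT_comp => //;
  exact: hat_measurable.
Qed.

End charSpace_measurable.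

(** A finite measure whose open sets are exhausted from inside by compact sets
    and that is outer regular is inner regular on all Borel sets: from a compact
    set of almost full measure, remove an open set that is barely larger than
    the complement of B. *)
Lemma content_radon (R : realType) (A : charAlgType R)
    (lam : set (charSpace A) -> R) (M : R) :
    (forall C, compact C -> 0 <= lam C) ->
    (forall C D, compact C -> compact D -> lam (C `|` D) <= lam C + lam D) ->
    (forall C D, compact C -> compact D -> C `&` D = set0 ->
       lam C + lam D <= lam (C `|` D)) ->
    (forall C, compact C -> lam C <= M) ->
  exists nu : {measure set (charSpace A) -> \bar R},
  [/\ radon nu,
      forall U, open U -> nu U =
        ereal_sup [set (lam C)%:E | C in [set C | compact C /\ C `<=` U]] &
      forall C, compact C -> ((lam C)%:E <= nu C)%E].
Proof.
move=> lam_ge0 lamU_le lamU lamM.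
have [mu [omu muU muC muE]] := content_outer_measure
  (@charSpace_hausdorff R A) lam_ge0 lamU_le lamU lamM.
have mid : measurable_fun setT
    (id : caratheodory_type mu -> charSpace A).
  move=> _ B mB; rewrite setTI preimage_id; move: B mB.
  apply: smallest_sub; last by move=> U /omu.
  split; first exact: caratheodory_measurable_set0.
  - by move=> B mB; rewrite setTD; exact: caratheodory_measurable_setC.
  - by move=> F mF; exact: caratheodory_measurable_bigcup.
pose nu := pushforward_measure
  (mu : {measure set (caratheodory_type mu) -> \bar R}) mid.
have nuE B : nu B = mu B by rewrite /nu /= /pushforward preimage_id.
exists nu; have nuT : (nu setT <= M%:E)%E.
  rewrite nuE muU; last exact: openT.
  by apply: ge_ereal_sup => _ [C [cC _] <-]; rewrite lee_fin lamM.
have nufin B : measurable B -> nu B = (fine (nu B))%:E.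
  move=> mB; rewrite fineK// ge0_fin_numE//.
  apply: le_lt_trans (ltry M); apply: le_trans nuT.
  by apply: le_measure; rewrite ?inE.
split.
- split.
    move=> alpha; exists setT; split=> //; first exact: openT.
    exact: le_lt_trans (ltry M).
  move=> B mB; apply/eqP; rewrite eq_le; apply/andP; split; last first.
    apply: ge_ereal_sup => _ [C [cC CB] <-]; apply: le_measure; rewrite ?inE//.
    exact: compact_charSpace_measurable.
  apply/lee_addgt0Pr => e e0; have e20 : 0 < e / 2 by lra.
  have [C0 [cC0 TC0]] : exists C0, compact C0 /\
      (nu setT <= nu C0 + (e / 2)%:E)%E.
    have nuT' := nufin _ measurableT; have : nu setT \is a fin_num by rewrite nuT'.
    rewrite nuE muU; last exact: openT.
    move=> /(ub_ereal_sup_adherent e20) [_ [C [cC _] <-]] h.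
    exists C; split => //; rewrite -leeBlDr//; apply: le_trans (ltW h) _.
    by rewrite nuE muC.
  have [G [oG BG Gle]] : exists G, [/\ open G, ~` B `<=` G &
      (nu G <= nu (~` B) + (e / 2)%:E)%E].
    have : nu (~` B) \is a fin_num by rewrite nufin//; exact: measurableC.
    rewrite nuE muE => /(lb_ereal_inf_adherent e20) [_ [G [oG BG] <-]] /ltW h.
    by exists G; rewrite nuE.
  have cC : compact (C0 `\` G) by apply: compact_closedI => //; exact: open_closedC.
  have mC0 := compact_charSpace_measurable cC0.
  have mC := compact_charSpace_measurable cC.
  have mG := open_charSpace_measurable oG.
  have mBC := measurableC mB.
  apply: (@le_trans _ _ (nu (C0 `\` G) + e%:E)%E); last first.
    rewrite leeD2r//; apply: ereal_sup_ubound; exists (C0 `\` G) => //.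
    split=> // x [_ nGx]; apply: contrapT => nBx; exact/nGx/BG.
  have h1 : (nu B + nu (~` B) = nu setT)%E.
    by rewrite -measureU// ?setICr// setUCr.
  have h2 : (nu C0 <= nu (C0 `\` G) + nu G)%E.
    rewrite -measureU//; last by rewrite setDKI.
    apply: le_measure; rewrite ?inE//; first exact: measurableU.
    by move=> x C0x; have [Gx|nGx] := pselect (G x); [right|left].
  move: h1 h2 TC0 Gle.
  rewrite (nufin B)// (nufin (~` B))// (nufin setT)// (nufin C0)//.
  rewrite (nufin G)// (nufin (C0 `\` G))// -!EFinD !lee_fin => -[].
  lra.
- by move=> U oU; rewrite nuE muU.
- by move=> C cC; rewrite nuE muC.
Qed.

(** * Hilbertian seminorms *)
Lemma discriminant_le (R : realFieldType) (a b c : R) : 0 <= a ->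
  (forall t, 0 <= a * t ^+ 2 - 2 * b * t + c) -> b ^+ 2 <= a * c.
Proof.
move=> a0 h; have [a_eq0|a_neq0] := eqVneq a 0.
  have [->|b_neq0] := eqVneq b 0; first by rewrite a_eq0 mul0r expr0n.
  have := h ((c + 1) / (2 * b)).
  have -> : 2 * b * ((c + 1) / (2 * b)) = c + 1.
    by rewrite mulrC divfK// mulf_neq0// pnatr_eq0.
  rewrite a_eq0; lra.
have a_gt0 : 0 < a by rewrite lt_neqAle eq_sym a_neq0.
have := h (b / a); rewrite -(pmulr_rge0 _ a_gt0).
have -> : a * (a * (b / a) ^+ 2 - 2 * b * (b / a) + c) = a * c - b ^+ 2.
  have ba : a * (b / a) = b by rewrite mulrC divfK.
  by move: ba; set t := b / a => <-; lra.
by rewrite subr_ge0.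
Qed.

Lemma sum_cauchy_schwarz (R : realFieldType) (I : Type) (s : seq I)
    (f g : I -> R) :
  (\sum_(i <- s) f i * g i) ^+ 2 <=
  (\sum_(i <- s) f i ^+ 2) * (\sum_(i <- s) g i ^+ 2).
Proof.
apply: discriminant_le; first by apply: sumr_ge0 => i _; exact: sqr_ge0.
move=> t; have h : 0 <= \sum_(i <- s) (f i * t - g i) ^+ 2.
  by apply: sumr_ge0 => i _; exact: sqr_ge0.
apply: le_trans h _; rewrite le_eqVlt; apply/orP; left.
apply/eqP; rewrite mulr_sumr !mulr_suml -sumrB -big_split/=.
by apply: eq_bigr => i _; lra.
Qed.

Lemma form_cauchy_schwarz (R : realType) (E : lmodType R) (B : {biscalar E}) :
  (forall u v, B u v = B v u) -> (forall v, 0 <= B v v) ->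
  forall u v, B u v ^+ 2 <= B u u * B v v.
Proof.
move=> B_sym B_ge0 u v; apply: discriminant_le => // t.
have := B_ge0 (t *: u - v).
rewrite linearBl !linearBr /= -/(B _ _).
have Zl c x y : B (c *: x) y = c * B x y by exact: linearZl_LR.
have Zr c x y : B x (c *: y) = c * B x y by exact: linearZr_LR.
rewrite !(Zl, Zr) (B_sym v u) => /le_trans; apply; lra.
Qed.

Lemma hilbertian_seminorm_of_form (R : realType) (E : lmodType R)
    (B : {biscalar E}) :
  (forall u v, B u v = B v u) -> (forall v, 0 <= B v v) ->
  exists p : hilbertian_seminorm E, forall v, p v ^+ 2 = B v v.
Proof.
move=> B_sym B_ge0; pose n v := Num.sqrt (B v v).
have nP : seminorm n.
  split=> [u v|c v].
    rewrite -(ler_pXn2r (n := 2)) ?nnegrE ?addr_ge0 ?sqrtr_ge0//.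
    rewrite sqrrD !sqr_sqrtr// linearDl !linearDr/= (B_sym v u).
    have : B u v <= n u * n v.
      apply: le_trans (ler_norm _) _.
      rewrite -(ler_pXn2r (n := 2)) ?nnegrE ?mulr_ge0 ?sqrtr_ge0//.
      by rewrite real_normK ?num_real// exprMn !sqr_sqrtr// form_cauchy_schwarz.
    lra.
  have -> : n (c *: v) = Num.sqrt (c ^+ 2 * B v v).
    rewrite /n; congr Num.sqrt.
    by rewrite linearZl_LR/= linearZr_LR/= mulrA.
  by rewrite sqrtrM ?sqr_ge0// sqrtr_sqr.
exists (@HilbertianSeminorm R E n nP B B_sym B_ge0 (fun=> erefl)) => v.
by rewrite sqr_sqrtr.
Qed.

(** Orthonormality is taken with respect to a form that may be degenerate: the
    expansion of a vector in an orthonormal list leaves a residual, which may be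
    a nonzero vector of the kernel of q. *)
Section hilbertian_theory.
Context (R : realType) (E : lmodType R) (q : hilbertian_seminorm E).
Implicit Types u v e : E.
Local Notation B := (hform q).

Lemma hnorm_ge0 v : 0 <= q v.
Proof. by rewrite hnormE sqrtr_ge0. Qed.

Lemma hnorm_sqr v : q v ^+ 2 = B v v.
Proof. by rewrite hnormE sqr_sqrtr// hform_ge0. Qed.

Lemma hnorm_scale c v : q (c *: v) = `|c| * q v.
Proof. exact: (hnorm_seminorm q).2. Qed.

Lemma hformZl c u v : B (c *: u) v = c * B u v.
Proof. exact: linearZl_LR. Qed.

Lemma hformZr c u v : B u (c *: v) = c * B u v.
Proof. exact: linearZr_LR. Qed.

Lemma hform_cauchy_schwarz u v : B u v ^+ 2 <= B u u * B v v.
Proof. by apply: form_cauchy_schwarz; [exact: hform_sym|exact: hform_ge0]. Qed.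

Lemma hform_ker u v : q u = 0 -> B u v = 0.
Proof.
move=> qu; have := hform_cauchy_schwarz u v.
rewrite -hnorm_sqr qu expr0n/= mul0r => h.
by apply/eqP; rewrite -sqrf_eq0 eq_le h sqr_ge0.
Qed.

Lemma hnorm_parallelogram u v :
  q (u + v) ^+ 2 + q (u - v) ^+ 2 = 2 * q u ^+ 2 + 2 * q v ^+ 2.
Proof.
by rewrite !hnorm_sqr !linearDl !linearDr !linearNl !linearNr /=; lra.
Qed.

Definition q_orthonormal_seq (s : seq E) : Prop :=
  uniq s /\ {in s &, forall e f, B e f = (e == f)%:R}.

Lemma orthonormal_hform_sum s (c : E -> R) e : q_orthonormal_seq s -> e \in s ->
  B (\sum_(f <- s) c f *: f) e = c e.
Proof.
move=> [us os] es; rewrite linear_sumlz (bigD1_seq e)//= hformZl.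
rewrite os// eqxx mulr1 big_seq_cond big1 ?addr0// => f /andP[fs fe].
by rewrite hformZl/= os// (negbTE fe) mulr0.
Qed.

Lemma orthonormal_hnorm_sum s (c : E -> R) : q_orthonormal_seq s ->
  q (\sum_(f <- s) c f *: f) ^+ 2 = \sum_(f <- s) c f ^+ 2.
Proof.
move=> os; rewrite hnorm_sqr linear_sumr.
rewrite big_seq [RHS]big_seq; apply: eq_bigr => f fs.
by rewrite hformZr/= orthonormal_hform_sum.
Qed.

Definition residual (s : seq E) w := w - \sum_(e <- s) B w e *: e.

Lemma residual_orthogonal s w e : q_orthonormal_seq s -> e \in s ->
  B (residual s w) e = 0.
Proof.
by move=> os es; rewrite linearBl/= orthonormal_hform_sum// subrr.
Qed.

Lemma bessel s w : q_orthonormal_seq s -> \sum_(e <- s) B w e ^+ 2 <= q w ^+ 2.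
Proof.
move=> os; have := hform_ge0 q (residual s w).
rewrite {2}/residual linearBr linear_sumr/=.
rewrite [X in _ - X]big_seq [X in _ - X]big1 ?subr0; last first.
  by move=> e es; rewrite hformZr/= residual_orthogonal// mulr0.
rewrite linearBl linear_sumlz/= hnorm_sqr subr_ge0; apply: le_trans.
rewrite le_eqVlt; apply/orP; left; apply/eqP/eq_bigr => e _.
by rewrite hformZl/= (hform_sym q e w).
Qed.

(** Each vector of F is expanded exactly, up to a residual of seminorm 0.  The
    last clause says that the orthonormal vectors are linear combinations of F,
    in the form in which it is used: every linear property of F passes to
    them. *)
Lemma gram_schmidt (F : seq E) : exists s : seq E,
  [/\ q_orthonormal_seq s,
      forall w, w \in F -> q (residual s w) = 0 &
      forall P : E -> Prop, P 0 ->
        (forall c u v, P u -> P v -> P (c *: u + v)) ->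
        (forall w, w \in F -> P w) -> forall e, e \in s -> P e].
Proof.
elim: F => [|w F [s [os Fs sP]]]; first by exists [::]; split.
have resP (P : E -> Prop) : P 0 ->
    (forall c u v, P u -> P v -> P (c *: u + v)) ->
    (forall w', w' \in w :: F -> P w') -> P (residual s w).
  move=> P0 PD PF; have PF' := sP P P0 PD (fun v vF =>
    PF v (@mem_behead _ (w :: F) v vF)).
  have Ps (t : seq E) : {subset t <= s} -> P (\sum_(e <- t) B w e *: e).
    elim: t => [_|e t IH ts]; first by rewrite big_nil.
    rewrite big_cons; apply: PD; first by apply: PF'; apply: ts; rewrite mem_head.
    by apply: IH => x xt; apply: ts; rewrite inE xt orbT.
  rewrite /residual -scaleN1r addrC; apply: PD; first exact: Ps.
  by apply: PF; rewrite mem_head.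
have [z0|z_neq0] := eqVneq (q (residual s w)) 0.
  exists s; split=> //.
    by move=> v; rewrite inE => /orP[/eqP ->|/Fs].
  move=> P P0 PD PF; apply: sP => // v vF; apply: PF.
  by rewrite inE vF orbT.
pose e := (q (residual s w))^-1 *: residual s w.
have eN : q e = 1.
  by rewrite hnorm_scale ger0_norm ?invr_ge0 ?hnorm_ge0// mulVf.
have eO f : f \in s -> B e f = 0.
  by move=> fs; rewrite hformZl/= residual_orthogonal// mulr0.
have e_notin : e \notin s.
  apply/negP => es; have := eO _ es.
  by rewrite -hnorm_sqr eN expr1n => /eqP; rewrite oner_eq0.
have os' : q_orthonormal_seq (e :: s).
  split; first by rewrite /= e_notin; case: os.
  move=> f g; rewrite !inE => /orP[/eqP ->|fs] /orP[/eqP ->|gs].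
  - by rewrite eqxx -hnorm_sqr eN expr1n.
  - by rewrite eO//; case: eqP => // eg; rewrite -eg (negbTE e_notin) in gs.
  - rewrite hform_sym eO//; case: eqP => // fe.
    by rewrite fe (negbTE e_notin) in fs.
  - exact: os.2.
exists (e :: s); split=> //.
  have resE v : residual (e :: s) v = residual s v - B v e *: e.
    by rewrite /residual big_cons opprD addrA addrAC.
  have BwE v : B (residual s v) e = B v e.
    rewrite linearBl/= linear_sumlz big_seq big1 ?subr0// => f fs.
    by rewrite hformZl/= (hform_sym q f e) eO// mulr0.
  move=> v; rewrite inE => /orP[/eqP ->|vF]; rewrite resE.
    rewrite -BwE /e hformZr/= -hnorm_sqr scalerA.
    set r := q (residual s w); have -> : r^-1 * r ^+ 2 / r = 1.
      by rewrite expr2 mulrA mulVf// mul1r mulfV.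
    by rewrite scale1r subrr hnormE linear0l sqrtr0.
  by rewrite -BwE hform_ker ?Fs// scale0r subr0 Fs.
move=> P P0 PD PF f; rewrite inE => /orP[/eqP ->|].
  by have Pr := resP P P0 PD PF; rewrite /e -[_ *: _]addr0; apply: PD.
by apply: sP => // v vF; apply: PF; rewrite inE vF orbT.
Qed.

End hilbertian_theory.

(** * Random signs and the inequality of Sazonov *)
Section random_signs.
Context (R : realType) (E : lmodType R).

(** The list of the 2 ^ n vectors \sum r_i e_i, for all choices of signs r_i;
    a sum over this list is 2 ^ n times an expectation over random signs. *)
Fixpoint sign_sums (s : seq E) : seq E :=
  if s is e :: s' then
    [seq u + e | u <- sign_sums s'] ++ [seq u - e | u <- sign_sums s']
  else [:: 0].

Lemma sign_sums_cons (f : E -> R) e s :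
  \sum_(u <- sign_sums (e :: s)) f u =
  \sum_(u <- sign_sums s) (f (u + e) + f (u - e)).
Proof. by rewrite big_cat !big_map/= big_split. Qed.

Lemma size_sign_sums s : size (sign_sums s) = (2 ^ size s)%N.
Proof.
by elim: s => //= e s IH; rewrite size_cat !size_map IH expnS mul2n addnn.
Qed.

Lemma sign_sumsP (P : E -> Prop) s : P 0 ->
  (forall u e, P u -> e \in s -> P (u + e) /\ P (u - e)) ->
  forall u, u \in sign_sums s -> P u.
Proof.
move=> P0; elim: s => [_ u|e s IH h u]; first by rewrite inE => /eqP ->.
have {}IH := IH (fun u e' Pu es => h u e' Pu (@mem_behead _ (e :: s) e' es)).
by rewrite mem_cat => /orP[] /mapP[v /IH Pv ->];
  have [] := h v e Pv (mem_head _ _).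
Qed.

Lemma sum_sign_sums_const s (c : R) :
  \sum_(u <- sign_sums s) c = (2 ^ size s)%:R * c.
Proof.
by rewrite big_const_seq count_predT size_sign_sums iter_addr_0 mulr_natl.
Qed.

(** The parallelogram law is what makes the mixed terms cancel; it covers both
    the square of a linear functional and the square of a Hilbertian
    seminorm. *)
Lemma sum_sign_sums_parallelogram (f : E -> R) s :
  (forall u v, f (u + v) + f (u - v) = 2 * f u + 2 * f v) ->
  \sum_(u <- sign_sums s) f u = (2 ^ size s)%:R * \sum_(e <- s) f e.
Proof.
move=> fP; have f0 : f 0 = 0 by have := fP 0 0; rewrite addr0 subr0; lra.
elim: s => [|e s IH]; first by rewrite /= big_seq1 big_nil mulr0.
rewrite sign_sums_cons big_cons; rewrite (eq_bigr _ (fun u _ => fP u e)).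
rewrite big_split/= -mulr_sumr IH sum_sign_sums_const /= expnS natrM; lra.
Qed.

(** For y = 0 this is the bound E[x^4] <= 3 E[x^2]^2; the shift y is there for
    the induction on the list. *)
Lemma sum_sign_sums_pow4 (x : E -> R) s y :
  (forall u v, x (u + v) = x u + x v) -> (forall u v, x (u - v) = x u - x v) ->
  \sum_(u <- sign_sums s) (y + x u) ^+ 4 <=
  (2 ^ size s)%:R * (y ^+ 4 + 6 * y ^+ 2 * (\sum_(e <- s) x e ^+ 2)
                     + 3 * (\sum_(e <- s) x e ^+ 2) ^+ 2).
Proof.
move=> xD xB; have x0 : x 0 = 0 by have := xD 0 0; rewrite addr0; lra.
elim: s y => [|e s IH] y.
  by rewrite /= big_seq1 big_nil x0; lra.
rewrite sign_sums_cons.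
under eq_bigr do rewrite xD xB !addrA [y + _ + _]addrAC [y + _ - _]addrAC.
rewrite big_split/= expnS natrM.
apply: le_trans (lerD (IH _) (IH _)) _.
rewrite big_cons; set N := (2 ^ size s)%:R; set a := x e.
set b := \sum_(j <- s) _.
rewrite -mulrDr (mulrC 2 N) -(mulrA N 2) ler_wpM2l ?ler0n//.
have := sqr_ge0 (a ^+ 2); lra.
Qed.

(** Second moment method: with the second and fourth moments of x u known, the
    event |x u| >= 1 has probability at least 1/6 when the second moment of x u
    exceeds 4. *)
Lemma sign_sums_anticoncentration (x : E -> R) s :
  (forall u v, x (u + v) = x u + x v) -> (forall u v, x (u - v) = x u - x v) ->
  4 < \sum_(e <- s) x e ^+ 2 ->
  (2 ^ size s)%:R <= 6 * \sum_(u <- sign_sums s) (1 <= `|x u|)%R%:R :> R.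
Proof.
move=> xD xB; set t := \sum_(e <- s) _ => t4.
have s2 := @sum_sign_sums_parallelogram (fun u => x u ^+ 2) s.
have {}s2 : \sum_(u <- sign_sums s) x u ^+ 2 = (2 ^ size s)%:R * t.
  by apply: s2 => u v; rewrite xD xB; lra.
have := @sum_sign_sums_pow4 x s 0 xD xB; rewrite /= -/t.
under eq_bigr do rewrite add0r.
set N := (2 ^ size s)%:R => s4.
have t0 : 0 < t by lra.
(* With tau = x u ^ 2 / t, of mean 1 and second moment at most 3, the function
   4 tau - 2/3 tau^2 - 1 has mean at least 1, never exceeds 5, and is
   nonpositive for tau <= 1/4, that is, whenever |x u| < 1. *)
pose h u := 4 * (x u ^+ 2 / t) - 4 / 6 * (x u ^+ 4 / t ^+ 2) - 1 : R.
have hle u : h u <= 6 * (1 <= `|x u|)%R%:R.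
  have hE : x u ^+ 4 / t ^+ 2 = (x u ^+ 2 / t) ^+ 2.
    by rewrite exprMn -exprM exprVn.
  rewrite /h hE; have [x1|x1] := lerP 1 `|x u|; rewrite ?mulr1n ?mulr0n.
    have := sqr_ge0 (x u ^+ 2 / t - 3); lra.
  have : x u ^+ 2 < 1 by rewrite -real_normK ?num_real// expr_lt1.
  move=> x21; have : x u ^+ 2 / t < 1 / 4.
    by rewrite ltr_pdivrMr//; lra.
  have : 0 <= x u ^+ 2 / t by rewrite divr_ge0 ?sqr_ge0// ltW.
  move=> h0 h1; have := sqr_ge0 (x u ^+ 2 / t); lra.
rewrite mulr_sumr; apply: (@le_trans _ _ (\sum_(u <- sign_sums s) h u));
  last exact: ler_sum.
rewrite /h !sumrB -!mulr_sumr -!mulr_suml s2 sum_sign_sums_const -/N.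
have N0 : 0 <= N by rewrite ler0n.
rewrite mulfK; last by rewrite gt_eqF.
have : (\sum_(i <- sign_sums s) x i ^+ 4) / t ^+ 2 <= 3 * N.
  by rewrite ler_pdivrMr ?exprn_gt0//; lra.
lra.
Qed.

End random_signs.

(** If every point of B lies in many of the sets F i, counted with weight, then
    the measures of the F i add up accordingly. *)
Lemma measure_count_le d (T : measurableType d) (R : realType)
    (mu : {measure set T -> \bar R}) (I : Type) (s : seq I) (F : I -> set T)
    (B : set T) (n c : R) : 0 <= n -> 0 <= c ->
  measurable B -> (forall i, measurable (F i)) ->
  (forall x, B x -> n <= c * \sum_(i <- s) (x \in F i)%:R) ->
  (n%:E * mu B <= c%:E * \sum_(i <- s) mu (F i))%E.
Proof.
move=> n0 c0 mB mF h.
have -> : (n%:E * mu B = \int[mu]_x (n * \1_B x)%:E)%E.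
  rewrite -[in LHS](setIT B) -integral_indic// -ge0_integralZl//.
    exact/measurable_EFinP/measurable_indic.
have -> : (\sum_(i <- s) mu (F i) =
           \int[mu]_x (\sum_(i <- s) \1_(F i) x)%:E)%E.
  under [RHS]eq_integral do rewrite -sumEFin.
  rewrite ge0_integral_sum//; last first.
    by move=> i; exact/measurable_EFinP/measurable_indic.
  by apply: eq_bigr => i _; rewrite integral_indic// setIT.
have mS : measurable_fun setT (fun x => (\sum_(i <- s) \1_(F i) x)%:E : \bar R).
  apply/measurable_EFinP; apply: measurable_sum => i; exact: measurable_indic.
rewrite -ge0_integralZl//; last first.
  by move=> x _; rewrite lee_fin sumr_ge0.
apply: ge0_le_integral => //.
- by move=> x _; rewrite lee_fin mulr_ge0.
- apply/measurable_EFinP; apply: measurable_funM => //.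
- by apply: measurable_funeM.
- move=> x _; rewrite -EFinM lee_fin indicE.
  have [xB|xB] := boolP (x \in B); last by rewrite mulr0 mulr_ge0// sumr_ge0.
  rewrite mulr1; apply: le_trans (h x (set_mem xB)) _.
  by rewrite le_eqVlt; apply/orP; left.
Qed.

Section sazonov.
Context d (T : measurableType d) (R : realType) (E : lmodType R).
Variables (mu : {measure set T -> \bar R}) (x : T -> E -> R) (f : E -> R).
Hypothesis muT : mu setT = 1%E.
Hypothesis xD : forall w u v, x w (u + v) = x w u + x w v.
Hypothesis xB : forall w u v, x w (u - v) = x w u - x w v.
Hypothesis mx : forall u, measurable_fun setT (x^~ u).
Hypothesis f_ge0 : forall u, 0 <= f u.
Hypothesis f_parallelogram : forall u v,
  f (u + v) + f (u - v) = 2 * f u + 2 * f v.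

(** If the image of mu under x is concentrated with respect to the quadratic
    seminorm f, then x is small on all of s at once, outside a set controlled by
    the trace of f along s.  When x is large on s, a fixed proportion of the
    sign sums u have |x u| >= 1, and each of these events is rare: by hypothesis
    if f u <= 1, and by the trivial bound 1 < f u otherwise. *)
Lemma sazonov_inequality (s : seq E) (eps : R) : 0 <= eps ->
  (forall u, u \in sign_sums s -> f u <= 1 ->
     (mu [set w | (1 <= `|x w u|)%R] <= eps%:E)%E) ->
  (mu [set w | (4 < \sum_(e <- s) x w e ^+ 2)%R] <=
     (6 * (eps + \sum_(e <- s) f e))%:E)%E.
Proof.
move=> eps0 conc.
have mlarge u : measurable [set w | 1 <= `|x w u|].
  by apply: measurable_superlevel_ge; exact: measurableT_comp.
have msum : measurable [set w | 4 < \sum_(e <- s) x w e ^+ 2].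
  apply: measurable_superlevel_gt.
  by apply: measurable_sum => e; exact: measurable_funX.
have N0 : 0 < (2 ^ size s)%:R :> R by rewrite ltr0n expn_gt0.
have := @measure_count_le _ _ _ mu _ (sign_sums s)
  (fun u => [set w | 1 <= `|x w u|]) [set w | 4 < \sum_(e <- s) x w e ^+ 2]
  (2 ^ size s)%:R 6 (ltW N0) (ler0n _ _) msum mlarge.
have memE w u : (w \in [set w | 1 <= `|x w u|]) = (1 <= `|x w u|).
  by apply/idP/idP; rewrite inE.
have anti w : 4 < \sum_(e <- s) x w e ^+ 2 -> (2 ^ size s)%:R <=
    6 * \sum_(u <- sign_sums s) (w \in [set w | 1 <= `|x w u|])%:R :> R.
  move=> /(sign_sums_anticoncentration (xD w) (xB w)) /le_trans; apply.
  by rewrite le_eqVlt; apply/orP; left; apply/eqP; congr (_ * _);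
    apply: eq_bigr => u _; rewrite memE.
move=> /(_ anti) h.
have bound u : u \in sign_sums s ->
    (mu [set w | (1 <= `|x w u|)%R] <= (eps + f u)%:E)%E.
  move=> us; have [fu|fu] := lerP (f u) 1.
    by apply: le_trans (conc _ us fu) _; rewrite lee_fin lerDl.
  apply: (@le_trans _ _ (mu setT)); first by apply: le_measure; rewrite ?inE.
  by rewrite muT lee_fin; lra.
have {}h : ((2 ^ size s)%:R%:E * mu [set w | (4 < \sum_(e <- s) x w e ^+ 2)%R]
    <= 6%:E * (\sum_(u <- sign_sums s) (eps + f u))%:E)%E.
  apply: le_trans h _; rewrite lee_pmul2l// -sumEFin.
  by rewrite big_seq [leRHS]big_seq; exact: lee_sum.
rewrite -(@lee_pmul2l _ (2 ^ size s)%:R%:E)//.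
apply: le_trans h _; rewrite -!EFinM lee_fin.
rewrite big_split/= sum_sign_sums_const sum_sign_sums_parallelogram//.
by lra.
Qed.

End sazonov.

(** * Ultralimits of characters *)
Lemma cvg_to_initial (S : choiceType) (T : topologicalType) (f : S -> T)
    (F : set_system S) (s : S) : Filter F ->
  f @ F --> f s -> F --> (s : initial_topology f).
Proof.
move=> FF Fs N; rewrite nbhsE => -[B [[U oU <-] Us] BN].
by apply: filterS BN _; apply: Fs; exact: open_nbhs_nbhs.
Qed.

Lemma ultra_compact_cvg (I : Type) (UU : set_system I) (X : topologicalType)
    (K : set X) (g : I -> X) : UltraFilter UU -> compact K ->
  (\forall i \near UU, K (g i)) -> exists2 l, K l & g @ UU --> l.
Proof.
move=> UUU cK Kg; have [l [Kl gl]] := cK (g @ UU) _ Kg.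
exists l => // N Nl /=; have [//|nN] := in_ultra_setVsetC (g @^-1` N) UUU.
by have [x []] := gl (~` N) N nN Nl.
Qed.

Lemma cvg_near_unique (I : Type) (UU : set_system I) (X : topologicalType)
    (f g : I -> X) (l m : X) : ProperFilter UU -> hausdorff_space X ->
  f @ UU --> l -> g @ UU --> m -> (\forall i \near UU, f i = g i) -> l = m.
Proof.
move=> UUP hX fl gm fg; apply: (cvg_unique _ fl) => //.
by apply: cvg_trans gm; apply: near_eq_cvg; near do apply/esym.
Unshelve. all: by end_near. Qed.

Lemma cvg_near_le (R : realType) (I : Type) (UU : set_system I)
    (UUP : ProperFilter UU) (f g : I -> R) (l m : R) :
  f @ UU --> l -> g @ UU --> m -> (\forall i \near UU, f i <= g i) -> l <= m.
Proof.
move=> fl gm fg; rewrite -subr_ge0; apply: (cvgr_to_ge (cvgB gm fl)).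
by apply: filterS fg => i; rewrite subr_ge0.
Qed.

Section generated_algebra.
Context (R : realType).

(** Induction over the subalgebra generated by G: the elements with the property
    P form a subalgebra. *)
Lemma gen_subalg_ind (A : comAlgType R) (G : set A) (P : A -> Prop) : P 0 -> P 1 ->
  (forall a b, P a -> P b -> P (a + b)) ->
  (forall c a, P a -> P (c *: a)) ->
  (forall a b, P a -> P b -> P (a * b)) ->
  (forall v, G v -> P v) -> forall a, a \in gen_subalg G -> P a.
Proof.
move=> P0 P1 PD PZ PM PG a /asboolP aG.
pose S0 : {pred A} := fun a => `[< P a >].
have S0P : GRing.subsemialg_closed S0.
  split; first exact/asboolP.
  - by split=> [|u v /asboolP Pu /asboolP Pv]; apply/asboolP => //; exact: PD.
  - by move=> c u /asboolP Pu; apply/asboolP; exact: PZ.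
  - by move=> u v /asboolP Pu /asboolP Pv; apply/asboolP; exact: PM.
pose S : subalgClosed A := HB.pack S0 (GRing.isSubalgClosed.Build R A S0 S0P).
by apply/asboolP; apply: (aG S) => g Gg; apply/asboolP; exact: PG.
Qed.

Lemma generated_ind (A : comAlgType R) (V : submodClosed A) (P : A -> Prop) :
  generated_by V -> P 0 -> P 1 ->
  (forall a b, P a -> P b -> P (a + b)) ->
  (forall c a, P a -> P (c *: a)) ->
  (forall a b, P a -> P b -> P (a * b)) ->
  (forall v, v \in V -> P v) -> forall a, P a.
Proof.
move=> [G GV GA] P0 P1 PD PZ PM PV a.
by apply: (gen_subalg_ind (G := G)) => // g /GV; exact: PV.
Qed.

End generated_algebra.

(** The functions f i need only be multiplicative and linear eventually, for
    each given elements of A: they will be extensions by zero of characters of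
    larger and larger subalgebras. *)
Section ultralimit_character.
Context (R : realType) (A : charAlgType R) (V : submodClosed A).
Context (I : Type) (UU : set_system I) (UUU : UltraFilter UU).
Variable f : I -> A -> R.

(** Boundedness on V passes to all of A because V generates A; bounded families
    converge along an ultrafilter, and identities pass to the limit. *)
Lemma ultralimit_character : generated_by V ->
  (forall a b, \forall i \near UU, f i (a + b) = f i a + f i b) ->
  (forall c a, \forall i \near UU, f i (c *: a) = c * f i a) ->
  (forall a b, \forall i \near UU, f i (a * b) = f i a * f i b) ->
  (\forall i \near UU, f i 1 = 1) ->
  (forall v, v \in V -> exists C : R, \forall i \near UU, `|f i v| <= C) ->
  exists alpha : charSpace A, forall a, f i a @[i --> UU] --> alpha a.
Proof.
move=> genV fD fZ fM f1 fV.
have bounded a : exists C : R, \forall i \near UU, `|f i a| <= C.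
  move: a; apply: (generated_ind genV) => //.
  - exists 0; apply: filterS (fZ 0 0) => i.
    by rewrite scale0r mul0r => ->; rewrite normr0.
  - by exists 1; apply: filterS f1 => i ->; rewrite normr1.
  - move=> a b [C Ca] [D Db]; exists (C + D).
    apply: filterS3 (fD a b) Ca Db => i -> aC bD.
    by apply: le_trans (ler_normD _ _) _; exact: lerD.
  - move=> c a [C Ca]; exists (`|c| * C).
    apply: filterS2 (fZ c a) Ca => i -> aC.
    by rewrite normrM ler_wpM2l.
  - move=> a b [C Ca] [D Db]; exists (C * D).
    apply: filterS3 (fM a b) Ca Db => i -> aC bD.
    by rewrite normrM ler_pM.
have limit a : exists l : R, f i a @[i --> UU] --> l.
  have [C Ca] := bounded a.
  have Ca' : \forall i \near UU, `[- C, C]%classic (f i a).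
    by apply: filterS Ca => i; rewrite /= in_itv/= ler_norml.
  by have [l _ fl] := ultra_compact_cvg UUU (@segment_compact _ _ _) Ca'; exists l.
pose l a := sval (cid (limit a)).
have fl a : f i a @[i --> UU] --> l a by rewrite /l; case: cid.
have hR := @Rhausdorff R.
have l_linear : linear_for *%R l.
  move=> c a b.
  have ca : c * f i a @[i --> UU] --> c * l a.
    by apply: cvgM; [exact: cvg_cst|exact: fl].
  apply: (cvg_near_unique _ hR (fl _) (cvgD ca (fl b))).
  by apply: filterS2 (fD (c *: a) b) (fZ c a) => i -> ->.
have l_monoid : GRing.monoid_morphism l.
  split=> [|a b].
    have c1 : (fun=> 1 : R) @ UU --> (1 : R) by exact: cvg_cst.
    by apply: (cvg_near_unique _ hR (fl 1) c1).
  by apply: (cvg_near_unique _ hR (fl _) (cvgM (fl a) (fl b))).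
pose alpha : {lrmorphism A -> R | *%R} := HB.pack l
  (GRing.isLinear.Build R A R *%R l l_linear)
  (GRing.isMonoidMorphism.Build A R l l_monoid).
by exists alpha.
Qed.

End ultralimit_character.

Section charSpace_topology.
Context (R : realType) (A : charAlgType R).

Lemma charSpace_cvg (F : set_system (charSpace A)) (alpha : charSpace A) :
  Filter F -> (forall a, hat a @ F --> hat a alpha) -> F --> alpha.
Proof.
move=> FF Fa; apply/(@cvg_sup _ _ _ F alpha FF) => a.
exact: (@cvg_to_initial _ _ (hat a)).
Qed.

Lemma charSpace_continuous (X : topologicalType) (f : X -> charSpace A) :
  (forall a, continuous (hat a \o f)) -> continuous f.
Proof.
by move=> cf x; apply: charSpace_cvg => a; exact: cf.
Qed.

(** The analogue for X(A) of the theorem of Banach and Alaoglu: an ultrafilter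
    on C converges pointwise to a character, by [ultralimit_character] applied
    to the tautological family. *)
Lemma charSpace_compact (V : submodClosed A) (C : set (charSpace A)) :
  generated_by V -> closed C ->
  (forall v, v \in V -> exists c, forall alpha, C alpha -> `|alpha v| <= c) ->
  compact C.
Proof.
move=> genV cC bC; rewrite compact_ultra => F FU FC.
have [||||v /bC[c hc]|alpha Fa] :=
    @ultralimit_character R A V _ F FU (fun alpha a => alpha a) genV.
- by move=> a b; apply: filterE => alpha; rewrite /char_fun rmorphD.
- by move=> c a; apply: filterE => alpha; rewrite /char_fun linearZ.
- by move=> a b; apply: filterE => alpha; rewrite /char_fun rmorphM.
- by apply: filterE => alpha; rewrite /char_fun rmorph1.
- by exists c; apply: filterS FC => alpha; exact: hc.
have Falpha : F --> alpha by exact: charSpace_cvg.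
exists alpha; split=> //.
by apply: cC => N Nalpha; exact: filter_ex (filterI FC (Falpha N Nalpha)).
Qed.

Lemma closed_hat_ge0 (a : A) : closed [set alpha : charSpace A | 0 <= alpha a].
Proof.
apply: (closed_comp (f := hat a)) (@closed_ge R 0) => // alpha _.
exact: hat_continuous.
Qed.

Lemma nonneg_chars_closed (Q : set A) : closed (nonneg_chars Q).
Proof.
rewrite (_ : nonneg_chars Q =
    \bigcap_(a in Q) [set alpha : charSpace A | 0 <= alpha a])//.
by apply: closed_bigI => a _; exact: closed_hat_ge0.
Qed.

Lemma closed_hat_norm_le (a : A) c :
  closed [set alpha : charSpace A | `|alpha a| <= c].
Proof.
apply: (closed_comp (f := Num.norm \o (hat a : charSpace A -> R)))
  (@closed_le R c) => // alpha _.
apply: continuous_comp; first exact: hat_continuous.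
exact: norm_continuous.
Qed.

End charSpace_topology.

(** * The limit of a net of measures *)

Lemma ptws_cvg (T I : Type) (R : realType) (F : set_system I)
    (f : I -> {ptws T -> R}) (z : {ptws T -> R}) : Filter F ->
  (forall a, f i a @[i --> F] --> z a) -> f @ F --> z.
Proof.
move=> FF h; have fFF : Filter (f @ F) by apply: fmap_filter.
apply/(@cvg_sup _ _ _ _ z fFF) => a.
by apply: (@cvg_to_initial _ _ (fun f : {ptws T -> R} => f a)); exact: h.
Qed.

(** P i W stands for the probability that a random function from A to R lies in
    the open set W.  The functions are not assumed to be characters of A: only
    their limits are, which is why X(A) is embedded into the space of all
    functions. *)
Section limit_measure.
Context (R : realType) (A : charAlgType R).
Context (I : Type) (UU : set_system I) (UUU : UltraFilter UU).
Local Notation Z := {ptws A -> R}.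

Definition pointwise (alpha : charSpace A) : Z := fun a => alpha a.

Lemma pointwise_continuous : continuous pointwise.
Proof.
move=> alpha; apply: ptws_cvg => [|a]; first exact: nbhs_filter.
exact: (@hat_continuous R A a alpha).
Qed.

Lemma pointwise_inj : injective pointwise.
Proof.
by move=> alpha beta ab; apply: charP => a; exact: (congr1 (fun f : Z => f a) ab).
Qed.

Lemma ptws_hausdorff : hausdorff_space Z.
Proof. by apply: hausdorff_product => a; exact: Rhausdorff. Qed.

Variable P : I -> set Z -> R.
Hypothesis P_ge0 : forall i W, open W -> 0 <= P i W.
Hypothesis P_le1 : forall i W, open W -> P i W <= 1.
Hypothesis P_le : forall i W W', open W -> open W' -> W `<=` W' -> P i W <= P i W'.
Hypothesis PU_le : forall i W W', open W -> open W' ->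
  P i (W `|` W') <= P i W + P i W'.
Hypothesis PU : forall i W W', open W -> open W' -> W `&` W' = set0 ->
  P i W + P i W' <= P i (W `|` W').

Let Plim (W : set Z) : R := lim (P i W @[i --> UU]).

Let P_cvg W : open W -> P i W @[i --> UU] --> Plim W.
Proof.
move=> oW; have h : \forall i \near UU, `[0, 1]%classic (P i W).
  by apply: filterE => i; rewrite /= in_itv/= P_ge0//= P_le1.
have [l _ Pl] := ultra_compact_cvg UUU (@segment_compact _ _ _) h.
by rewrite /Plim; apply/cvg_ex; exists l.
Qed.

Let Plim_ge0 W : open W -> 0 <= Plim W.
Proof.
move=> oW; apply: limr_ge; first by apply/cvg_ex; exists (Plim W); exact: P_cvg.
by apply: filterE => i; exact: P_ge0.
Qed.

Let Plim_le W W' : open W -> open W' -> W `<=` W' -> Plim W <= Plim W'.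
Proof.
move=> oW oW' WW'; apply: (cvg_near_le _ (P_cvg oW) (P_cvg oW')).
by apply: filterE => i; exact: P_le.
Qed.

Let PlimU_le W W' : open W -> open W' -> Plim (W `|` W') <= Plim W + Plim W'.
Proof.
move=> oW oW'; have oU := openU oW oW'.
apply: (cvg_near_le _ (P_cvg oU) (cvgD (P_cvg oW) (P_cvg oW'))).
by apply: filterE => i; exact: PU_le.
Qed.

Let PlimU W W' : open W -> open W' -> W `&` W' = set0 ->
  Plim W + Plim W' <= Plim (W `|` W').
Proof.
move=> oW oW' WW'; have oU := openU oW oW'.
apply: (cvg_near_le _ (cvgD (P_cvg oW) (P_cvg oW')) (P_cvg oU)).
by apply: filterE => i; exact: PU.
Qed.

(** The limit mass of a compact set is taken over its open neighbourhoods in the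
    space of all functions: the P i of the image of C itself may all vanish. *)
Let nbhds (C : set (charSpace A)) :=
  [set Plim W | W in [set W : set Z | open W /\ C `<=` pointwise @^-1` W]].
Let lam (C : set (charSpace A)) : R := inf (nbhds C).

Let lam_lb C W : open W -> C `<=` pointwise @^-1` W -> lam C <= Plim W.
Proof.
move=> oW CW; apply: ge_inf; last by exists W.
by exists 0 => _ [W' [oW' _] <-]; exact: Plim_ge0.
Qed.

Let le_lam C x :
  (forall W, open W -> C `<=` pointwise @^-1` W -> x <= Plim W) -> x <= lam C.
Proof.
move=> h; apply: lb_le_inf; first by exists (Plim setT), setT => //; split => //; exact: openT.
by move=> _ [W [oW CW] <-]; exact: h.
Qed.

(** Masses of open sets do not increase in the limit; conversely, a compact set
    all of whose neighbourhoods eventually have mass c keeps mass c. *)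
Lemma limit_measure : exists nu : {measure set (charSpace A) -> \bar R},
  [/\ radon nu,
      forall W : set Z, open W -> exists2 l, P i W @[i --> UU] --> l &
        (nu (pointwise @^-1` W) <= l%:E)%E &
      forall C c, compact C ->
        (forall W : set Z, open W -> C `<=` pointwise @^-1` W ->
           \forall i \near UU, c <= P i W) ->
        (c%:E <= nu C)%E].
Proof.
have [C cC|C D cC cD|C D cC cD CD0|C cC|nu [radon_nu nuU nuC]] :=
    @content_radon R A lam 1.
- by apply: le_lam => W oW _; exact: Plim_ge0.
- rewrite -lerBlDr; apply: le_lam => W oW CW.
  rewrite lerBlDr -lerBlDl; apply: le_lam => W' oW' DW'; rewrite lerBlDl.
  apply: le_trans (PlimU_le oW oW').
  apply: lam_lb; first exact: openU.
  by move=> x [/CW|/DW']; [left|right].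
- apply: le_lam => W oW CDW.
  have [|U [U' [oU oU' CU DU' UU'0]]] := compact_disjoint_open ptws_hausdorff
      (continuous_compact (continuous_subspaceT pointwise_continuous) cC)
      (continuous_compact (continuous_subspaceT pointwise_continuous) cD).
    rewrite -subset0 => _ [[x Cx <-] [y Dy /pointwise_inj xy]].
    suff : (C `&` D) x by rewrite CD0.
    by split=> //; rewrite -xy.
  have oWU : open (W `&` U) by exact: openI.
  have oWU' : open (W `&` U') by exact: openI.
  apply: (@le_trans _ _ (Plim (W `&` U) + Plim (W `&` U'))).
    apply: lerD; apply: lam_lb => // x Ex; split.
    - by apply: CDW; left.
    - by apply: CU; exists x.
    - by apply: CDW; right.
    - by apply: DU'; exists x.
  apply: (@le_trans _ _ (Plim ((W `&` U) `|` (W `&` U')))).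
    by apply: PlimU => //; rewrite setIACA UU'0 setI0.
  by apply: Plim_le => //; [exact: openU|move=> x [[]|[]]].
- apply: (@le_trans _ _ (Plim setT)); first by apply: lam_lb => //; exact: openT.
  have oT : open (setT : set Z) by exact: openT.
  apply: limr_le; first by apply/cvg_ex; exists (Plim setT); exact: P_cvg.
  by apply: filterE => i; exact: P_le1.
exists nu; split=> //.
- move=> W oW; exists (Plim W); first exact: P_cvg.
  rewrite nuU; last by apply: open_comp => // x _; exact: pointwise_continuous.
  by apply: ge_ereal_sup => _ [C [cC CW] <-]; rewrite lee_fin lam_lb.
- move=> C c cC h; apply: le_trans (nuC C cC); rewrite lee_fin.
  apply: le_lam => W oW CW; apply: limr_ge; last exact: h.
  by apply/cvg_ex; exists (Plim W); exact: P_cvg.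
Qed.

End limit_measure.

(** * Tightness of concentrated families *)

(** Compactness for a cover that is closed under finite unions: one member is
    enough. *)
Lemma compact_directed_cover (T : topologicalType) (K : set T)
    (N : set (set T)) : compact K -> N set0 ->
  (forall U W, N U -> N W -> N (U `|` W)) ->
  (forall x, K x -> exists U, [/\ N U, open U & U x]) ->
  exists2 U, N U & K `<=` U.
Proof.
move=> cK N0 NU cov.
pose F := filter_from N (fun U => [set W | N W /\ U `<=` W]).
have FF : Filter F.
  apply: filter_from_filter; first by exists set0.
  move=> U W NUU NW; exists (U `|` W); first exact: NU.
  by move=> X [NX UWX]; split; split=> // x Ux; apply: UWX; [left|right].
have : \forall W \near F, K `<=` W.
  apply: (compact_near_coveringP K).1 => // x Kx.
  have [U [NUU oU Ux]] := cov x Kx.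
  exists (U, [set W | N W /\ U `<=` W]).
    by split => /=; [exact: open_nbhs_nbhs (conj oU Ux)|exists U].
  by move=> [y W]/= [Uy [_ UW]]; exact: UW.
by move=> [U NUU /(_ U (conj NUU (@subset_refl _ U))) KU]; exists U.
Qed.

Section radon_facts.
Context (R : realType) (A : charAlgType R).
Variable mu : {measure set (charSpace A) -> \bar R}.

(** The complement of the support is an uncountable union of null open sets; it
    is null because each compact subset is covered by finitely many of them. *)
Lemma radon_support_null (K : set (charSpace A)) : radon mu -> closed K ->
  measure_support mu `<=` K -> mu (~` K) = 0%E.
Proof.
move=> [_ inner] cK sK; apply/eqP; rewrite eq_le measure_ge0 andbT.
have mK : measurable (~` K).
  by apply: measurableC; exact: closed_charSpace_measurable.
rewrite inner//; apply: ge_ereal_sup => _ [C [cC CK] <-].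
have [||x /CK nKx|U [oU U0] CU] :=
    @compact_directed_cover _ C [set U | open U /\ mu U = 0%E] cC.
- by split; [exact: open0|exact: measure0].
- move=> U W [oU U0] [oW W0]; split; first exact: openU.
  by rewrite measureU0//; apply: open_charSpace_measurable.
- have /existsNP[D /not_implyP[[cD D0] nDx]] : ~ measure_support mu x.
    by move=> /sK.
  by exists (~` D); split=> //; [split=> //|]; exact: closed_openC.
rewrite -U0; apply: le_measure; rewrite ?inE//.
- exact: compact_charSpace_measurable.
- exact: open_charSpace_measurable.
Qed.

Lemma representing_radon_total (l : A -> R) :
  representing_radon l mu -> l 1 = 1 -> mu setT = 1%E.
Proof.
move=> [_ /(_ 1)[_]] h l1; move: h; rewrite l1 => ->.
under eq_integral do rewrite /hat /char_fun rmorph1.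
by rewrite integral_cst// mul1e.
Qed.

End radon_facts.

Lemma ae_all_seq d (T : measurableType d) (R : realType)
    (mu : {measure set T -> \bar R}) (I : eqType) (s : seq I)
    (P : I -> T -> Prop) :
  (forall i, i \in s -> {ae mu, forall x, P i x}) ->
  {ae mu, forall x, forall i, i \in s -> P i x}.
Proof.
elim: s => [|i s IH] h; first exact: aeW.
have hs : {ae mu, forall x, forall j, j \in s -> P j x}.
  by apply: IH => j js; apply: h; rewrite inE js orbT.
have hi := h i (mem_head i s).
by apply: filterS2 hi hs => x Pix Px j; rewrite inE => /orP[/eqP ->|/Px].
Qed.

Section tightness.
Context (R : realType) (A : charAlgType R) (V : submodClosed A).
Context (p q : hilbertian_seminorm (subspace_type V)) (t : R).
Hypothesis ker_qp : forall v, q v = 0 -> p v = 0.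
Hypothesis trace_le : forall s, q_orthonormal_seq q s -> \sum_(e <- s) p e ^+ 2 <= t.

Context (S : subalgClosed A).
Local Notation X := (charSpace (subalg_type S)).
Variable nu : {measure set X -> \bar R}.
Hypothesis nuT : nu setT = 1%E.

(** The condition of concentration for one subalgebra S, with fixed epsilon and
    delta. *)
Definition small_prob (eps delta : R) : Prop :=
  forall (v : subspace_type V) (s : subalg_type S), p v <= delta ->
    val v = val s -> (nu [set alpha | (1 <= `|alpha s|)%R] <= eps%:E)%E.

(** All multiples of v are in every semiball of p, so alpha (k s) is below 1 in
    absolute value almost surely for every k. *)
Lemma small_prob_ker v (s : subalg_type S) :
  (forall eps, 0 < eps -> exists2 delta, 0 < delta & small_prob eps delta) ->
  val v = val s -> p v = 0 -> {ae nu, forall alpha : X, alpha s = 0}.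
Proof.
move=> conc vs pv0.
have h k : {ae nu, forall alpha : X, `|alpha (k%:R *: s)| < 1}.
  exists [set alpha : X | 1 <= `|alpha (k%:R *: s)|]; split.
  - exact: measurable_hat_norm_ge.
  - apply/eqP; rewrite eq_le measure_ge0 andbT; apply/lee_addgt0Pr => e e0.
    have [delta delta0 sp] := conc e e0.
    rewrite add0e; apply: (sp (k%:R *: v)).
      by rewrite hnorm_scale pv0 mulr0 ltW.
    by rewrite !linearZ/= vs.
  - by move=> alpha /= /negP; rewrite -leNgt.
have := ae_foralln h; apply: filterS => alpha hk.
apply/eqP/negPn/negP => a0.
have [n an] : exists n : nat, `|alpha s|^-1 <= n%:R.
  by exists (Num.truncn `|alpha s|^-1).+1; rewrite ltW// truncnS_gt.
have := hk n; rewrite /char_fun linearZ/= normrM normr_nat.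
have as0 : 0 < `|alpha s| by rewrite normr_gt0.
by apply/negP; rewrite -leNgt -ler_pdivrMr// div1r.
Qed.

(** The bound depends on S and F only through eps and delta, which is the
    uniformity that the limit needs.  Gram-Schmidt reduces the vectors of F to
    q-orthonormal vectors, up to residuals in the kernel of q, on which almost
    every character vanishes; the inequality of Sazonov then applies. *)
Lemma tight_bound (Q : set X) (F : seq (subspace_type V)) (eps delta n : R) :
  (forall w, w \in F -> val w \in S) ->
  (forall eps, 0 < eps -> exists2 delta, 0 < delta & small_prob eps delta) ->
  {ae nu, forall alpha : X, Q alpha} ->
  0 <= eps -> 0 < delta -> 0 < n -> small_prob eps delta ->
  exists B : set X, [/\ measurable B,
    (nu B <= (6 * (eps + 4 * t / (n ^+ 2 * delta ^+ 2)))%:E)%E &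
    forall alpha, ~ B alpha ->
      Q alpha /\ forall w (s : subalg_type S), w \in F -> val w = val s ->
        `|alpha s| <= n * q w].
Proof.
move=> FS conc aeQ eps0 delta0 n0 sp.
have [s [os Fs sP]] := gram_schmidt q F.
pose lift (v : subspace_type V) : subalg_type S := insubd 0 (val v).
have liftE v : val v \in S -> val (lift v) = val v.
  by move=> vS; rewrite /lift insubdK.
have spanS e : e \in s -> val e \in S.
  apply: (sP (fun e => val e \in S)) => //; first by rewrite raddf0 rpred0.
  by move=> c u v uS vS; rewrite linearP/= rpredD ?rpredZ.
have sumS (c : subspace_type V -> R) r : {subset r <= s} ->
    val (\sum_(e <- r) c e *: e) \in S.
  move=> rs; rewrite linear_sum big_seq rpred_sum// => e er.
  by rewrite linearZ/= rpredZ// spanS// rs.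
have resS w : w \in F -> val (residual q s w) \in S.
  by move=> wF; rewrite /residual -scaleN1r linearD linearZ/= rpredD ?rpredZ ?sumS ?FS.
have ae0 : {ae nu, forall alpha : X, forall w, w \in F ->
    alpha (lift (residual q s w)) = 0}.
  apply: ae_all_seq => w wF.
  apply: (small_prob_ker (v := residual q s w)) => //; first by rewrite liftE// resS.
  exact/ker_qp/Fs.
have [N [mN N0 hN]] : {ae nu, forall alpha : X, Q alpha /\ forall w, w \in F ->
    alpha (lift (residual q s w)) = 0}.
  exact: filterS2 aeQ ae0.
pose c := 2 / n.
have c0 : 0 < c by rewrite divr_gt0.
(* Vectors of V at which p is evaluated and elements of S at which characters
   are evaluated have different types; a pair carries both versions of the same
   element of A. *)
pose E : lmodType R := (subspace_type V * subalg_type S)%type.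
pose s' : seq E := [seq (c *: e, c *: lift e) | e <- s].
pose x (alpha : X) (u : E) := alpha u.2.
pose f (u : E) := p u.1 ^+ 2 / delta ^+ 2.
pose B0 := [set alpha | 4 < \sum_(e <- s') x alpha e ^+ 2].
have mB0 : measurable B0.
  apply: measurable_superlevel_gt.
  by apply: measurable_sum => e; apply: measurable_funX; exact: hat_measurable.
exists (N `|` B0); split.
- exact: measurableU.
- have -> : nu (N `|` B0) = nu B0 by rewrite setUC measureU0.
  apply: (@le_trans _ _ (6 * (eps + \sum_(e <- s') f e))%:E); last first.
    rewrite lee_fin ler_pM2l// lerD2l big_map /f /=.
    under eq_bigr do rewrite hnorm_scale exprMn -mulrA.
    rewrite -mulr_sumr -mulr_suml real_normK ?num_real//.
    have -> : 4 * t / (n ^+ 2 * delta ^+ 2) = c ^+ 2 * (t / delta ^+ 2).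
      by rewrite /c expr_div_n invfM; lra.
    by rewrite ler_wpM2l ?sqr_ge0// ler_wpM2r ?invr_ge0 ?sqr_ge0// trace_le.
  apply: (@sazonov_inequality _ _ _ E nu x f) => //.
  + by move=> w u v; rewrite /x /char_fun raddfD.
  + by move=> w u v; rewrite /x /char_fun raddfB.
  + by move=> u; exact: hat_measurable.
  + by move=> u; rewrite /f divr_ge0 ?sqr_ge0.
  + move=> u v; rewrite /f -mulrDl hnorm_parallelogram; lra.
  + move=> u us fu; apply: (sp u.1).
      rewrite -(ler_pXn2r (n := 2)) ?nnegrE ?hnorm_ge0 ?(ltW delta0)//.
      by move: fu; rewrite /f ler_pdivrMr ?exprn_gt0// mul1r.
    move: u us {fu}; apply: sign_sumsP; first by rewrite !raddf0.
    move=> u _ uE /mapP[e es ->]; split.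
      change (val (u.1 + c *: e) = val (u.2 + c *: lift e)).
      by rewrite !linearD !linearZ/= uE liftE// spanS.
    change (val (u.1 - c *: e) = val (u.2 - c *: lift e)).
    by rewrite !linearB !linearZ/= uE liftE// spanS.
- move=> alpha /not_orP[nN nB].
  have [Qa a0] : Q alpha /\ forall w, w \in F -> alpha (lift (residual q s w)) = 0.
    by apply: contrapT => /hN.
  split=> // w r wF wr.
  have sum_le : \sum_(e <- s) alpha (lift e) ^+ 2 <= n ^+ 2.
    move/negP: nB; rewrite -leNgt big_map /x /=.
    under eq_bigr do rewrite /char_fun linearZ/= exprMn.
    rewrite -mulr_sumr -ler_pdivlMl ?exprn_gt0// => /le_trans; apply.
    by rewrite /c expr_div_n invf_div; lra.
  have -> : r = \sum_(e <- s) hform q w e *: lift e + lift (residual q s w).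
    have sumE : val (\sum_(e <- s) hform q w e *: lift e) =
        val (\sum_(e <- s) hform q w e *: e).
      rewrite !linear_sum big_seq [RHS]big_seq; apply: eq_bigr => e es.
      by rewrite !linearZ/= liftE ?spanS.
    apply: val_inj; rewrite -wr linearD/= sumE liftE ?resS//.
    by rewrite -linearD /residual addrC subrK.
  rewrite /char_fun raddfD/= [X in _ + X](a0 w wF) addr0.
  rewrite -(ler_pXn2r (n := 2)) ?nnegrE ?mulr_ge0 ?hnorm_ge0 ?(ltW n0)//.
  rewrite real_normK ?num_real// linear_sum.
  under eq_bigr do rewrite linearZ/=.
  apply: le_trans (sum_cauchy_schwarz _ _ _) _.
  rewrite exprMn mulrC ler_pM ?sumr_ge0//; first by move=> *; exact: sqr_ge0.
    by move=> *; exact: sqr_ge0.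
  exact: bessel.
Qed.

End tightness.

(** * Integrals as limits of layer sums *)

(** The sums \sum_k e 1_(f > (k+1) e) approximate a nonnegative function f from
    below within 2 e.  The layers are strict superlevel sets, hence open when f
    is continuous; this is what lets bounds on open sets turn into bounds on
    integrals. *)
Lemma layer_sum_le (R : realFieldType) (e y : R) N : 0 < e -> 0 <= y ->
  \sum_(k < N) e * (k.+1%:R * e < y)%R%:R <= y.
Proof.
move=> e0 y0; suff : \sum_(k < N) e * (k.+1%:R * e < y)%R%:R <= y /\
    \sum_(k < N) e * (k.+1%:R * e < y)%R%:R <= N%:R * e by case.
elim: N => [|N [IH1 IH2]]; first by rewrite big_ord0 mul0r.
rewrite !big_ord_recr/=; case: (ltP (N.+1%:R * e) y) => h.
  rewrite mulr1; move: h; rewrite -natr1; lra.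
by rewrite mulr0 addr0 -natr1; split=> //; lra.
Qed.

Lemma layer_sum_ge (R : archiRealFieldType) (e y : R) : 0 < e -> 0 <= y ->
  exists N, y <= 2 * e + \sum_(k < N) e * (k.+1%:R * e < y)%R%:R.
Proof.
move=> e0 y0; have ye0 : 0 <= y / e by rewrite divr_ge0 // ltW.
have /andP[h1 h2] := truncn_itv ye0.
set n := Num.truncn (y / e) in h1 h2.
exists n.-1; have hn k : (k < n.-1)%N -> k.+1%:R * e < y.
  move=> kn; rewrite -ltr_pdivlMr//; apply: lt_le_trans h1.
  by rewrite ltr_nat; case: n kn {h2} => //=.
rewrite (eq_bigr (fun=> e)); last by move=> k _; rewrite hn// mulr1.
rewrite sumr_const card_ord -mulr_natl.
move: h2; rewrite ltr_pdivrMr// => h2.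
case: n h2 {h1 hn} => [|n] /=; rewrite -?natr1; lra.
Qed.

Section layers.
Context d (T : measurableType d) (R : realType).
Variables (mu : {measure set T -> \bar R}) (f : T -> R).
Hypotheses (mf : measurable_fun setT f) (f_ge0 : forall x, 0 <= f x).

Let measurable_layer c : measurable [set x | c < f x].
Proof. exact: measurable_superlevel_gt. Qed.

Let integral_layer e c : (0 <= e) ->
  (\int[mu]_x (e * (c < f x)%R%:R)%:E = e%:E * mu [set x | (c < f x)%R])%E.
Proof.
move=> e0; rewrite -[in RHS](setIT [set x | c < f x]) -integral_indic//.
rewrite -ge0_integralZl//; last exact/measurable_EFinP/measurable_indic.
apply: eq_integral => x _; rewrite -EFinM indicE; congr (_ * _%:R)%:E.
by congr nat_of_bool; apply/idP/idP; rewrite inE.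
Qed.

Let measurable_layer_fun e c :
  measurable_fun setT (fun x => (e * (c < f x)%R%:R)%:E : \bar R).
Proof.
apply/measurable_EFinP; apply: measurable_funM => //.
rewrite (_ : (fun x => _) = \1_[set x | c < f x]); first exact: measurable_indic.
apply/funext => x; rewrite indicE; congr (_%:R); congr nat_of_bool.
by apply/idP/idP; rewrite inE.
Qed.

Lemma layer_sum_le_integral (e : R) N : 0 < e ->
  (\sum_(k < N) e%:E * mu [set x | (k.+1%:R * e < f x)%R] <=
   \int[mu]_x (f x)%:E)%E.
Proof.
move=> e0; rewrite (eq_bigr (fun k : 'I_N =>
  \int[mu]_x (e * (k.+1%:R * e < f x)%R%:R)%:E)%E); last first.
  by move=> k _; rewrite integral_layer// ltW.
rewrite -ge0_integral_sum//; last first.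
  by move=> k x _; rewrite lee_fin mulr_ge0// ltW.
apply: ge0_le_integral => //.
- by move=> x _; apply: sume_ge0 => k _; rewrite lee_fin mulr_ge0// ltW.
- by apply: emeasurable_sum => k.
- exact/measurable_EFinP.
- by move=> x _; rewrite sumEFin lee_fin layer_sum_le.
Qed.

Lemma integral_le_layer_sum (c : R) : mu setT = 1%E ->
  (forall e N, 0 < e ->
     (\sum_(k < N) e%:E * mu [set x | (k.+1%:R * e < f x)%R] <= c%:E)%E) ->
  (\int[mu]_x (f x)%:E <= c%:E)%E.
Proof.
move=> muT h; apply/lee_addgt0Pr => e' e'0.
pose e := e' / 2; have e0 : 0 < e by rewrite divr_gt0.
pose g k x := (e * (k.+1%:R * e < f x)%R%:R)%:E : \bar R.
have g0 k x : (0 <= g k x)%E by rewrite lee_fin mulr_ge0// ltW.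
have mS : measurable_fun setT (fun x => \sum_(k <oo) g k x)%E.
  apply: (@ge0_emeasurable_sum _ _ _ setT g xpredT) => [k x _ _|k _].
    exact: g0.
  exact: measurable_layer_fun.
apply: (@le_trans _ _ (\int[mu]_x ((2 * e)%:E + \sum_(k <oo) g k x))%E).
  apply: ge0_le_integral => //.
  - by move=> x _; rewrite lee_fin.
  - exact/measurable_EFinP.
  - exact: emeasurable_funD.
  - move=> x _; have [N hN] := layer_sum_ge e0 (f_ge0 x).
    apply: (@le_trans _ _ ((2 * e)%:E + \sum_(0 <= k < N) g k x)%E).
      by rewrite big_mkord sumEFin -EFinD lee_fin.
    by rewrite leeD2l//; apply: nneseries_lim_ge => k _ _; exact: g0.
rewrite ge0_integralD//; last 2 first.
- by move=> x _; rewrite lee_fin mulr_ge0// ltW.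
- by move=> x _; exact: nneseries_ge0.
rewrite integral_cst// [X in (_ * X)%E]muT mule1 addeC.
rewrite integral_nneseries//; last by move=> k; exact: measurable_layer_fun.
apply: leeD; last by rewrite lee_fin /e; lra.
apply: lime_le.
  by apply: is_cvg_nneseries => k _ _; apply: integral_ge0 => x _; exact: g0.
apply: nearW => N; rewrite big_mkord; apply: le_trans (h e N e0).
by apply: lee_sum => k _; rewrite integral_layer// ltW.
Qed.

End layers.

(** * Finitely generated subalgebras *)
Section finite_subalgebras.
Context (R : realType) (A : charAlgType R) (V : submodClosed A).

Definition fin_subalg (F : seq (subspace_type V)) : subalgClosed A :=
  gen_subalg [set a | exists2 v, v \in F & a = val v].

Lemma fin_subalg_mem F v : v \in F -> val v \in fin_subalg F.
Proof. by move=> vF; apply/asboolP => S GS; apply: GS; exists v. Qed.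

Lemma fin_subalgP F : fin_gen_subalgs V (fin_subalg F).
Proof.
pose n := size F; pose b (i : 'I_n) : A := val (tnth (in_tuple F) i).
pose W0 : {pred A} := fun a => `[< exists c : 'I_n -> R, a = \sum_i c i *: b i >].
have W0P : GRing.subsemimod_closed W0.
  split; first split.
  - by apply/asboolP; exists (fun=> 0); rewrite big1// => i _; rewrite scale0r.
  - move=> u v /asboolP[c ->] /asboolP[d ->]; apply/asboolP.
    exists (fun i => c i + d i); rewrite -big_split/=.
    by apply: eq_bigr => i _; rewrite scalerDl.
  - move=> k u /asboolP[c ->]; apply/asboolP; exists (fun i => k * c i).
    by rewrite scaler_sumr; apply: eq_bigr => i _; rewrite scalerA.
pose W : submodClosed A := HB.pack W0 (GRing.isSubmodClosed.Build R A W0 W0P).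
have bW i : b i \in W.
  apply/asboolP; exists (fun j => (j == i)%:R).
  rewrite (bigD1 i)//= eqxx scale1r big1 ?addr0// => j /negbTE ->.
  by rewrite scale0r.
exists W; split.
- move=> a /asboolP[c ->]; apply: rpred_sum => i _; apply: rpredZ.
  exact: (valP (tnth (in_tuple F) i)).
- exists n, b; split=> // w /asboolP[c wE]; by exists c.
- move=> a; apply/idP/idP => /asboolP aS; apply/asboolP => S GS.
    apply: (aS S) => _ [v vF ->]; apply: GS.
    have /tnthP[i ->] : v \in in_tuple F by [].
    exact: (bW i).
  apply: (aS S) => g /asboolP[c ->]; apply: rpred_sum => i _; apply: rpredZ.
  by apply: GS; exists (tnth (in_tuple F) i) => //; exact: mem_tnth.
Qed.

Lemma fin_subalg_eventually (UU : set_system (seq (subspace_type V))) :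
  Filter UU -> generated_by V ->
  (forall F0 : seq (subspace_type V), \forall F \near UU,
     {subset F0 <= (F : seq (subspace_type V))}) ->
  forall a : A, \forall F \near UU, a \in fin_subalg F.
Proof.
move=> UUF genV UUsub; apply: (generated_ind genV).
- by apply: filterE => F; exact: rpred0.
- by apply: filterE => F; exact: rpred1.
- by move=> a b; apply: filterS2 => F; exact: rpredD.
- by move=> c a; apply: filterS => F; exact: rpredZ.
- by move=> a b; apply: filterS2 => F; exact: rpredM.
- move=> v vV; apply: filterS (UUsub [:: exist _ v vV]) => F sF.
  by apply: (@fin_subalg_mem F (exist _ v vV)); apply: sF; rewrite mem_head.
Qed.

(** Two lists are both included in their concatenation, so the sets of lists that
    include a given one generate a proper filter. *)
Lemma inclusion_ultrafilter (T : eqType) :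
  exists2 UU : set_system (seq T), UltraFilter UU &
    forall F0 : seq T, \forall F \near UU, {subset F0 <= (F : seq T)}.
Proof.
pose base := filter_from [set: seq T] (fun F0 =>
  [set F : seq T | {subset F0 <= F}]).
have PB : ProperFilter base.
  apply: filter_from_proper; last by move=> F _; exists F => /=.
  apply: filter_from_filter; first by exists [::].
  move=> F G _ _; exists (F ++ G) => // H sH.
  by split=> x xF; apply: sH; rewrite mem_cat xF ?orbT.
have [UU [UUU sUU]] := ultraFilterLemma PB.
by exists UU => // F0; apply: sUU; exists F0.
Qed.

End finite_subalgebras.

Section extension_by_zero.
Context (R : realType) (A : charAlgType R) (S : subalgClosed A).

(** Extension by zero: [insubd] sends the elements outside S to 0. *)
Definition zero_ext (alpha : charSpace (subalg_type S)) : {ptws A -> R} :=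
  fun a => alpha (insubd (0 : subalg_type S) a).

Lemma zero_extE alpha (s : subalg_type S) : zero_ext alpha (val s) = alpha s.
Proof. by rewrite /zero_ext valKd. Qed.

Lemma zero_ext_continuous : continuous zero_ext.
Proof.
move=> alpha; apply: ptws_cvg => [|a]; first exact: nbhs_filter.
exact: (@hat_continuous R _ _ alpha).
Qed.

Lemma zero_extD alpha a b : a \in S -> b \in S ->
  zero_ext alpha (a + b) = zero_ext alpha a + zero_ext alpha b.
Proof.
move=> aS bS; pose s : subalg_type S := Sub a aS; pose t : subalg_type S := Sub b bS.
have -> : a + b = val (s + t) by rewrite linearD.
by rewrite -[a]/(val s) -[b]/(val t) !zero_extE /char_fun linearD.
Qed.

Lemma zero_extZ alpha c a : a \in S ->
  zero_ext alpha (c *: a) = c * zero_ext alpha a.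
Proof.
move=> aS; pose s : subalg_type S := Sub a aS.
have -> : c *: a = val (c *: s) by rewrite linearZ.
by rewrite -[a]/(val s) !zero_extE /char_fun linearZ.
Qed.

Lemma zero_extM alpha a b : a \in S -> b \in S ->
  zero_ext alpha (a * b) = zero_ext alpha a * zero_ext alpha b.
Proof.
move=> aS bS; pose s : subalg_type S := Sub a aS; pose t : subalg_type S := Sub b bS.
have -> : a * b = val (s * t) by rewrite rmorphM.
by rewrite -[a]/(val s) -[b]/(val t) !zero_extE /char_fun rmorphM.
Qed.

Lemma zero_ext1 alpha : zero_ext alpha 1 = 1.
Proof.
have -> : 1 = val (1 : subalg_type S) by rewrite rmorph1.
by rewrite zero_extE /char_fun rmorph1.
Qed.

End extension_by_zero.

(** * First moments from second moments *)
Section moments.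
Context (R : realType) (A : charAlgType R) (L : {scalar A}).
Variable nu : {measure set (charSpace A) -> \bar R}.

Lemma measurable_hat_sqr (a : A) :
  measurable_fun setT (fun alpha : charSpace A => ((alpha a) ^+ 2)%:E).
Proof.
by apply/measurable_EFinP/measurable_funX; exact: hat_measurable.
Qed.

Lemma integrable_one : nu setT = 1%E ->
  nu.-integrable setT (cst 1%E : charSpace A -> \bar R).
Proof.
move=> nuT; apply/integrableP; split => //.
rewrite (eq_integral (cst 1%E)); last by move=> alpha _; rewrite /= normr1.
by rewrite integral_cst// [X in (_ * X)%E]nuT mule1 ltry.
Qed.

Lemma integrable_hat (a : A) : nu setT = 1%E ->
  (\int[nu]_alpha ((alpha a) ^+ 2)%:E < +oo)%E ->
  nu.-integrable setT (EFin \o hat a) /\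
  nu.-integrable setT (fun alpha => ((alpha a) ^+ 2)%:E).
Proof.
move=> nuT fin2.
have int2 : nu.-integrable setT (fun alpha => ((alpha a) ^+ 2)%:E).
  apply/integrableP; split; first exact: measurable_hat_sqr.
  apply: le_lt_trans fin2; apply: ge0_le_integral => //.
  - by apply: measurableT_comp => //; exact: measurable_hat_sqr.
  - exact: measurable_hat_sqr.
  - by move=> alpha _; rewrite abse_EFin ger0_norm ?sqr_ge0.
have int1 := integrable_one nuT.
split=> //; apply: (le_integrable measurableT _ _ (integrableD measurableT int1 int2)).
  by apply/measurable_EFinP; exact: hat_measurable.
move=> alpha _; change (`|alpha a|%:E <= `|1 + alpha a ^+ 2|%:E)%E.
rewrite lee_fin.
rewrite [X in _ <= X]ger0_norm ?addr_ge0 ?sqr_ge0//.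
rewrite -[alpha a ^+ 2]real_normK ?num_real//.
by have := sqr_ge0 (`|alpha a| - 1 / 2); lra.
Qed.

(** For b = 1 + s a the hypothesis compares two polynomials of degree 2 in s
    with the same constant term, valid for all real s of either sign; the linear
    coefficients are therefore equal. *)
Lemma moments_of_second_moments : nu setT = 1%E -> L 1 = 1 ->
  (forall b : A, \int[nu]_alpha ((alpha b) ^+ 2)%:E <= (L (b ^+ 2))%:E)%E ->
  forall a, nu.-integrable setT (EFin \o hat a) /\
    ((L a)%:E = \int[nu]_alpha (hat a alpha)%:E)%E.
Proof.
move=> nuT L1 h a.
have [i1 i2] := integrable_hat nuT (le_lt_trans (h a) (ltry _)).
split=> //.
have /fineK e1 := integrable_fin_num measurableT i1.
have /fineK e2 := integrable_fin_num measurableT i2.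
set E1 := fine _ in e1; set E2 := fine _ in e2.
have key s : 1 + (2 * s * E1 + s ^+ 2 * E2) <= 1 + (2 * s * L a + s ^+ 2 * L (a ^+ 2)).
  have := h (1 + s *: a).
  have -> : L ((1 + s *: a) ^+ 2) = 1 + (2 * s * L a + s ^+ 2 * L (a ^+ 2)).
    rewrite sqrrD expr1n mul1r exprZn -addrA raddfD/= L1; congr (_ + _).
    by rewrite mulr2n !linearD !linearZ/=; lra.
  move=> /(le_trans _); rewrite -lee_fin; apply.
  rewrite (_ : (\int[nu]_alpha _)%E = (\int[nu]_alpha
      (1%E + ((2 * s)%:E * (hat a alpha)%:E + (s ^+ 2)%:E * (alpha a ^+ 2)%:E)))%E).
    have int1 := integrable_one nuT.
    have j1 := integrableZl measurableT (2 * s) i1.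
    have j2 := integrableZl measurableT (s ^+ 2) i2.
    rewrite integralD//; last exact: integrableD.
    rewrite integral_cst// [X in (_ * X)%E]nuT mule1 integralD//.
    by rewrite !integralZl// -e1 -e2 -!EFinM -!EFinD.
  apply: eq_integral => alpha _; rewrite -!EFinM -!EFinD; congr (_%:E).
  by rewrite /hat /char_fun raddfD/= rmorph1 linearZ/=; lra.
rewrite -e1; congr (_%:E); apply/eqP; rewrite -subr_eq0 -sqrf_eq0 eq_le sqr_ge0 andbT.
rewrite -(mulr0 (L (a ^+ 2) - E2)).
have E2le : 0 <= L (a ^+ 2) - E2 by rewrite subr_ge0 -lee_fin e2.
rewrite -sqrrN opprB.
apply: discriminant_le => // s; have := key s; lra.
Qed.

End moments.

(** * The measure of a concentrated family *)
Section trace.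
Context (R : realType) (E : lmodType R) (p q : hilbertian_seminorm E).

Lemma seminorm_trace_finite : (seminorm_trace p q < +oo)%E ->
  (forall v, q v = 0 -> p v = 0) /\ exists2 t, 0 <= t &
    forall s, q_orthonormal_seq q s -> \sum_(e <- s) p e ^+ 2 <= t.
Proof.
rewrite /seminorm_trace; case: asboolP => // ker; set X := [set _ | _ in _].
have le_sup s : q_orthonormal_seq q s ->
    ((\sum_(e <- s) p e ^+ 2)%:E <= ereal_sup X)%E.
  move=> [us os]; apply: ereal_sup_ubound; exists [fset e in s]%fset.
    by move=> e f; rewrite !inE; exact: os.
  congr (_%:E); apply: perm_big; apply: uniq_perm => [||e].
  - exact: fset_uniq.
  - exact: us.
  - by rewrite !inE.
have sup_ge0 : (0 <= ereal_sup X)%E.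
  by have := le_sup [::]; rewrite big_nil; apply; split.
move=> fin; split=> //; have /fineK supE : ereal_sup X \is a fin_num.
  by rewrite ge0_fin_numE.
exists (fine (ereal_sup X)); first exact: fine_ge0.
by move=> s /le_sup; rewrite -supE lee_fin.
Qed.

End trace.

Section measure_of_concentrated_family.
Context (R : realType) (A : charAlgType R) (V : submodClosed A).
Context (q : hilbertian_seminorm (subspace_type V)).
Context (L : {scalar A}) (Q : set A).
Hypothesis genV : generated_by V.
Hypothesis L1 : L 1 = 1.

(** The multiple by n of the unit ball of the dual of (V, q), cut out of K: a
    compact set of characters, and these sets exhaust the q-continuous characters
    in K. *)
Definition dual_ball (n : R) : set (charSpace A) :=
  [set alpha | nonneg_chars Q alpha /\
     forall v : subspace_type V, `|alpha (val v)| <= n * q v].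

Lemma dual_ball_closed n : closed (dual_ball n).
Proof.
rewrite (_ : dual_ball n = nonneg_chars Q `&`
    \bigcap_(v in [set: subspace_type V])
      [set alpha : charSpace A | `|alpha (val v)| <= n * q v]).
  apply: closedI; first exact: nonneg_chars_closed.
  by apply: closed_bigI => v _; exact: closed_hat_norm_le.
apply/seteqP; split=> alpha [Qa Va]; split=> // v.
  by move=> _; exact: Va.
exact: (Va v I).
Qed.

Lemma dual_ball_compact n : compact (dual_ball n).
Proof.
apply: (charSpace_compact genV (@dual_ball_closed n)) => v vV.
by exists (n * q (exist _ v vV)) => alpha [_ /(_ (exist _ v vV))].
Qed.

Lemma continuous_charsE :
  continuous_chars (nonneg_chars Q) q = \bigcup_k dual_ball k.+1%:R.
Proof.
apply/seteqP; split=> [alpha [Qa [C C0 hC]]|alpha [k _ [Qa hk]]].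
  exists (Num.truncn C) => //; split=> // v; apply: le_trans (hC v) _.
  by rewrite ler_wpM2r ?hnorm_ge0// ltW// truncnS_gt.
by split=> //; exists k.+1%:R.
Qed.

Variable p : hilbertian_seminorm (subspace_type V).
Hypothesis trace_fin : (seminorm_trace p q < +oo)%E.
Variable nu : forall S : subalgClosed A,
  {measure set (charSpace (subalg_type S)) -> \bar R}.
Hypothesis nu_repr : forall S, fin_gen_subalgs V S ->
  representing_radon (fun s : subalg_type S => L (val s)) (nu S) /\
  measure_support (nu S) `<=` nonneg_chars [set s : subalg_type S | Q (val s)].
Hypothesis nu_conc : concentrated p (fin_gen_subalgs V) nu.

Let nuT (F : seq (subspace_type V)) : nu (fin_subalg F) setT = 1%E.
Proof.
apply: representing_radon_total (nu_repr (fin_subalgP F)).1 _.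
by rewrite rmorph1.
Qed.

Let small eps : 0 < eps -> exists2 delta, 0 < delta &
  forall F : seq (subspace_type V), small_prob p (nu (fin_subalg F)) eps delta.
Proof.
move=> /nu_conc [delta delta0 h]; exists delta => // F v s pv vs.
by apply: (h _ (fin_subalgP F) v s) => //.
Qed.

(** Each measure of the family gives mass at most eta to the characters outside
    the finite-dimensional shadow of the dual ball of radius n, with n independent
    of the subalgebra. *)
Let exceptional (eta : R) : 0 < eta -> exists2 n : R, 0 < n &
  forall F : seq (subspace_type V),
  exists B : set (charSpace (subalg_type (fin_subalg F))), [/\ measurable B,
    (nu (fin_subalg F) B <= eta%:E)%E &
    forall alpha, ~ B alpha ->
      (forall a, Q a -> 0 <= zero_ext alpha a) /\
      forall w, w \in F -> `|zero_ext alpha (val w)| <= n * q w].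
Proof.
move=> eta0; have [ker [t t0 ht]] := seminorm_trace_finite trace_fin.
have eps0 : 0 < eta / 12 by rewrite divr_gt0.
have [delta delta0 sp] := small eps0.
(* The bound 6 (eps + 4 t / (n delta)^2) of tight_bound is at most eta when
   eps = eta / 12 and n^2 >= 48 t / (eta delta^2). *)
pose r := 48 * t / (eta * delta ^+ 2).
have r0 : 0 <= r by rewrite divr_ge0 ?mulr_ge0 ?sqr_ge0// ltW.
exists (r + 1); first by rewrite ltr_wpDl.
move=> F; have n0 : 0 < r + 1 by rewrite ltr_wpDl.
have aeQ : {ae nu (fin_subalg F),
    forall alpha : charSpace (subalg_type (fin_subalg F)),
    nonneg_chars [set s : subalg_type (fin_subalg F) | Q (val s)] alpha}.
  have [[rad _] supp] := nu_repr (fin_subalgP F).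
  set K := nonneg_chars _ in supp *.
  have cK : closed K by exact: nonneg_chars_closed.
  exists (~` K); split => //; last exact: radon_support_null.
  by apply: measurableC; exact: closed_charSpace_measurable.
have conc e : 0 < e -> exists2 d, 0 < d & small_prob p (nu (fin_subalg F)) e d.
  by move=> /small [d d0 hd]; exists d.
have [B [mB nB hB]] := tight_bound ker ht (nuT F) (@fin_subalg_mem _ _ _ F)
  conc aeQ (ltW eps0) delta0 n0 (sp F).
exists B; split=> //.
  apply: le_trans nB _; rewrite lee_fin.
  have h1 : 4 * t = eta / 12 * (r * delta ^+ 2).
    rewrite /r invfM.
    have hd : (delta ^+ 2)^-1 * delta ^+ 2 = 1 by rewrite mulVf// gt_eqF ?exprn_gt0.
    have he : eta * eta^-1 = 1 by rewrite mulfV// gt_eqF.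
    rewrite -[_ * (_ * _) * delta ^+ 2]mulrA -[_^-1 * _ * delta ^+ 2]mulrA hd mulr1.
    by rewrite mulrCA [eta / 12]mulrC -!mulrA he; lra.
  have h2 : 4 * t / ((r + 1) ^+ 2 * delta ^+ 2) <= eta / 12.
    rewrite ler_pdivrMr ?mulr_gt0 ?exprn_gt0// h1 ler_wpM2l ?(ltW eps0)//.
    rewrite ler_wpM2r ?sqr_ge0//; have := sqr_ge0 r; lra.
  lra.
move=> alpha /hB[Qa hw]; split=> [a aQ|w wF].
  have [aS|aS] := boolP (a \in fin_subalg F).
    have -> : a = val (Sub a aS : subalg_type (fin_subalg F)) by [].
    by rewrite zero_extE; apply: Qa.
  by rewrite /zero_ext /insubd insubN//= /char_fun raddf0.
pose s : subalg_type (fin_subalg F) := Sub (val w) (fin_subalg_mem wF).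
by rewrite -[X in zero_ext _ X]/(val s) zero_extE; exact: hw.
Qed.

Let preimage_measurable (F : seq (subspace_type V)) (W : set {ptws A -> R}) : open W ->
  measurable (@zero_ext _ _ (fin_subalg F) @^-1` W).
Proof.
move=> oW; apply: open_charSpace_measurable.
by apply: open_comp => // x _; exact: zero_ext_continuous.
Qed.

Let P (F : seq (subspace_type V)) (W : set {ptws A -> R}) : R :=
  fine (nu (fin_subalg F) (@zero_ext _ _ (fin_subalg F) @^-1` W)).

Let PE F W : open W ->
  (P F W)%:E = nu (fin_subalg F) (@zero_ext _ _ (fin_subalg F) @^-1` W).
Proof.
move=> oW; rewrite /P fineK// ge0_fin_numE// (@le_lt_trans _ _ 1%E) ?ltry//.
rewrite -(nuT F); apply: le_measure; rewrite ?inE//; exact: preimage_measurable.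
Qed.

Lemma measure_of_concentrated_family :
  exists mu : {measure set (charSpace A) -> \bar R},
    representing_radon L mu /\
    mu (~` continuous_chars (nonneg_chars Q) q) = 0%E.
Proof.
have [UU UUU UUsub] := inclusion_ultrafilter (subspace_type V).
have UUalg a : \forall F \near UU, a \in fin_subalg F.
  exact: fin_subalg_eventually genV UUsub a.
have [||i W W' oW oW' WW'|i W W' oW oW'|i W W' oW oW' WW'0|mu [rad_mu muW muC]] :=
    @limit_measure R A _ UU UUU P.
- by move=> i W oW; rewrite -lee_fin PE.
- move=> i W oW; rewrite -lee_fin PE// -(nuT i).
  by apply: le_measure; rewrite ?inE//; exact: preimage_measurable.
- rewrite -lee_fin !PE//; apply: le_measure; rewrite ?inE.
  + exact: preimage_measurable.
  + exact: preimage_measurable.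
  + by move=> x; exact: WW'.
- have oU := openU oW oW'; rewrite -lee_fin EFinD !PE//.
  by apply: measureU2; exact: preimage_measurable.
- have oU := openU oW oW'; rewrite -lee_fin EFinD !PE//.
  rewrite preimage_setU measureU//; [exact: preimage_measurable|
    exact: preimage_measurable|by rewrite -preimage_setI WW'0 preimage_set0].
have muT_le1 : (mu setT <= 1)%E.
  have [l Pl] := muW setT openT; rewrite preimage_setT => /le_trans; apply.
  rewrite lee_fin; apply: (cvgr_to_le Pl); apply: filterE => F.
  by rewrite -lee_fin PE//; [rewrite preimage_setT nuT|exact: openT].
(* If a neighbourhood W of the dual ball failed to contain the good characters
   along the ultrafilter, the failing ones would have an ultralimit, which is a
   character in the dual ball, hence in W. *)
have tight eta : 0 < eta -> exists n : R, ((1 - eta)%:E <= mu (dual_ball n))%E.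
  move=> eta0; have [n n0 hn] := exceptional eta0; exists n.
  apply: muC; first exact: dual_ball_compact.
  move=> W oW CW.
  pose B F := sval (cid (hn F)).
  have mB F : measurable (B F) by rewrite /B; case: cid => ? [].
  have nuB F : (nu (fin_subalg F) (B F) <= eta%:E)%E by rewrite /B; case: cid => ? [].
  have hB F : forall alpha, ~ B F alpha ->
      (forall a, Q a -> 0 <= zero_ext alpha a) /\
      forall w, w \in F -> `|zero_ext alpha (val w)| <= n * q w.
    by rewrite /B; case: cid => ? [].
  have : \forall F \near UU, forall alpha, ~ B F alpha -> W (zero_ext alpha).
    have [//|bad] := in_ultra_setVsetC
      [set F | forall alpha, ~ B F alpha -> W (zero_ext alpha)] UUU.
    exfalso.
    have badE F : exists alpha : charSpace (subalg_type (fin_subalg F)),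
        (~` [set F | forall alpha, ~ B F alpha -> W (zero_ext alpha)]) F ->
        ~ B F alpha /\ ~ W (zero_ext alpha).
      have [good|/existsNP[alpha /not_implyP[nB nW]]] := pselect
        (forall alpha, ~ B F alpha -> W (zero_ext alpha)); last by exists alpha.
      by exists point => /(_ good).
    pose al F := sval (cid (badE F)).
    have al_bad : \forall F \near UU, ~ B F (al F) /\ ~ W (zero_ext (al F)).
      by apply: filterS bad => F; rewrite /al; case: cid.
    have al_ball : \forall F \near UU, (forall a, Q a -> 0 <= zero_ext (al F) a) /\
        forall w, w \in F -> `|zero_ext (al F) (val w)| <= n * q w.
      by apply: filterS al_bad => F [/hB].
    have al_v (v : subspace_type V) :
        \forall F \near UU, `|zero_ext (al F) (val v)| <= n * q v.
      apply: filterS2 al_ball (UUsub [:: v]) => F [_ h] sF; apply: h.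
      by apply: sF; rewrite mem_head.
    have [a b|c a|a b||v vV|alpha al_cvg] :=
        @ultralimit_character R A V _ UU UUU (fun F => zero_ext (al F)) genV.
    - by apply: filterS2 (UUalg a) (UUalg b) => F; exact: zero_extD.
    - by apply: filterS (UUalg a) => F; exact: zero_extZ.
    - by apply: filterS2 (UUalg a) (UUalg b) => F; exact: zero_extM.
    - by apply: filterE => F; exact: zero_ext1.
    - by exists (n * q (exist _ v vV)); exact: (al_v (exist _ v vV)).
    have alpha_ball : dual_ball n alpha.
      split=> [a Qa|v].
        apply: (cvgr_to_ge (al_cvg a)); apply: filterS al_ball => F [h _].
        exact: h.
      apply: (cvgr_to_le (cvg_norm (al_cvg (val v)))); exact: al_v.
    have : \forall F \near UU, W (zero_ext (al F)).
      apply: (ptws_cvg _ al_cvg); apply: open_nbhs_nbhs; split=> //.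
      exact: CW.
    by move=> al_W; have [F [[_]]] := filter_ex (filterI al_bad al_W).
  apply: filterS => F good; rewrite -lee_fin PE//.
  apply: (@le_trans _ _ (nu (fin_subalg F) (~` B F))); last first.
    apply: le_measure; rewrite ?inE.
    - exact: measurableC.
    - exact: preimage_measurable.
    - exact: good.
  have : (nu (fin_subalg F) (B F) + nu (fin_subalg F) (~` B F) = 1)%E.
    by rewrite -measureU ?setUCr ?setICr//; [exact: nuT|exact: measurableC].
  rewrite EFinB leeBlDr// => <-; rewrite addeC leeD2l//.
have muT : mu setT = 1%E.
  apply/eqP; rewrite eq_le muT_le1; apply/lee_addgt0Pr => e e0.
  have [n hn] := tight e e0.
  rewrite -leeBlDr// -EFinB; apply: le_trans hn _.
  apply: le_measure; rewrite ?inE//; apply: closed_charSpace_measurable.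
  exact: dual_ball_closed.
exists mu; split.
- split=> //; apply: moments_of_second_moments => // b.
  apply: integral_le_layer_sum => //.
  + by apply: measurable_funX; exact: hat_measurable.
  + by move=> alpha; exact: sqr_ge0.
  move=> e N e0.
  pose W (k : nat) : set {ptws A -> R} := [set z | k.+1%:R * e < z b ^+ 2].
  have oW k : open (W k).
    have oV : open [set y : R | k.+1%:R * e < y ^+ 2].
      apply: (@open_comp _ _ (fun y : R => y ^+ 2) [set y | k.+1%:R * e < y]).
        by move=> y _; exact: exprn_continuous.
      exact: open_gt.
    apply: (@open_comp _ _ (fun z : {ptws A -> R} => z b) _ _ oV) => z _.
    exact: (@proj_continuous A (fun=> R) b).
  have lW k : exists2 l, P F (W k) @[F --> UU] --> l &
      (mu [set alpha | (k.+1%:R * e < alpha b ^+ 2)%R] <= l%:E)%E.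
    by have := muW (W k) (oW k).
  pose l k := s2val (cid2 (lW k)).
  have lP k : P F (W k) @[F --> UU] --> l k by rewrite /l; case: cid2.
  have lmu k : (mu [set alpha | (k.+1%:R * e < alpha b ^+ 2)%R] <= (l k)%:E)%E.
    by rewrite /l; case: cid2.
  apply: (@le_trans _ _ (\sum_(k < N) e * l k)%:E).
    rewrite -sumEFin; apply: lee_sum => k _.
    by rewrite EFinM; apply: lee_wpmul2l; [rewrite lee_fin ltW|exact: lmu].
  rewrite lee_fin.
  have sum_cvg : \sum_(k < N) e * P F (W k) @[F --> UU] --> \sum_(k < N) e * l k.
    apply: cvg_big => [|k _]; first exact: add_continuous.
    by apply: cvgM; [exact: cvg_cst|exact: lP].
  apply: (cvgr_to_le sum_cvg); apply: filterS (UUalg b) => F bF.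
  pose s : subalg_type (fin_subalg F) := Sub b bF.
  rewrite -lee_fin -sumEFin.
  have [[_ hs] _] := nu_repr (fin_subalgP F).
  have := (hs (s ^+ 2)).2; rewrite rmorphXn /= => ->.
  rewrite (eq_integral (fun alpha => ((hat s alpha) ^+ 2)%:E)); last first.
    by move=> alpha _; rewrite /hat /char_fun rmorphXn.
  have mh : measurable_fun setT (fun alpha => (hat s alpha) ^+ 2).
    by apply: measurable_funX; exact: hat_measurable.
  apply: le_trans (layer_sum_le_integral (nu (fin_subalg F)) mh
    (fun alpha => sqr_ge0 _) N e0).
  apply: lee_sum => k _; rewrite EFinM PE//.
  apply: lee_wpmul2l; first by rewrite lee_fin ltW.
  rewrite le_eqVlt; apply/orP; left; apply/eqP; congr (nu _ _).
  apply/funext => alpha; rewrite /W /preimage /=.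
  by rewrite -[b]/(val s) zero_extE.
- rewrite continuous_charsE.
  have mball n : measurable (dual_ball n).
    by apply: closed_charSpace_measurable; exact: dual_ball_closed.
  have mU : measurable (\bigcup_k dual_ball k.+1%:R).
    by apply: bigcupT_measurable => k; exact: mball.
  apply/eqP; rewrite eq_le measure_ge0 andbT; apply/lee_addgt0Pr => e e0.
  have [n hn] := tight e e0; rewrite add0e.
  have sub : dual_ball n `<=` \bigcup_k dual_ball k.+1%:R.
    move=> alpha [Qa hv]; exists (Num.truncn n) => //; split=> // v.
    apply: le_trans (hv v) _.
    by rewrite ler_wpM2r ?hnorm_ge0// ltW// truncnS_gt.
  have : (mu (dual_ball n) + mu (~` \bigcup_k dual_ball k.+1%:R) <= 1)%E.
    rewrite -measureU//; [|exact: measurableC|].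
      by apply: le_trans muT_le1; apply: le_measure; rewrite ?inE//;
        apply: measurableU => //; exact: measurableC.
    by rewrite -subset0 => x [/sub Ux nUx].
  have fn : mu (~` \bigcup_k dual_ball k.+1%:R) \is a fin_num.
    rewrite ge0_fin_numE// (@le_lt_trans _ _ 1%E) ?ltry// -muT.
    by apply: le_measure; rewrite ?inE//; exact: measurableC.
  move: hn; rewrite -(fineK fn); case: (mu (dual_ball n)) => [r| |]//=.
  by rewrite -EFinD !lee_fin; lra.
Qed.

End measure_of_concentrated_family.

(** * A seminorm that dominates almost all characters *)
Section dual_weight.
Context (R : realType) (A : charAlgType R) (V : submodClosed A).
Variable q : hilbertian_seminorm (subspace_type V).
Implicit Types alpha : charSpace A.

(** The infimum of these numbers is 1 / (1 + |alpha|^2), where |alpha| is the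
    dual norm of alpha with respect to q, and 0 if alpha is not q-continuous.
    As an infimum of continuous functions it is upper semicontinuous in
    alpha. *)
Definition weight_bounds alpha : set R :=
  [set (1 + alpha (val v) ^+ 2)^-1 | v in [set v : subspace_type V | q v <= 1]].
Definition dual_weight alpha : R := inf (weight_bounds alpha).

Let den_gt0 alpha (a : A) : 0 < 1 + alpha a ^+ 2.
Proof. by rewrite ltr_pwDl ?sqr_ge0. Qed.

Let bounds_lb alpha : lbound (weight_bounds alpha) 0.
Proof. by move=> _ [v _ <-]; rewrite invr_ge0 ltW. Qed.

Let q0 : q 0 <= 1.
Proof. by rewrite -[0](scale0r 0) hnorm_scale normr0 mul0r. Qed.

Let bounds_ex alpha : weight_bounds alpha !=set0.
Proof. by exists (1 + alpha (val (0 : subspace_type V)) ^+ 2)^-1, 0. Qed.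

Lemma dual_weight_ge0 alpha : 0 <= dual_weight alpha.
Proof. exact: lb_le_inf. Qed.

Let weight_le alpha v : q v <= 1 ->
  dual_weight alpha <= (1 + alpha (val v) ^+ 2)^-1.
Proof. by move=> qv; apply: ge_inf; [exists 0; exact: bounds_lb|exists v]. Qed.

Lemma dual_weight_le1 alpha : dual_weight alpha <= 1.
Proof.
apply: le_trans (weight_le alpha q0) _.
by rewrite invf_le1// lerDl sqr_ge0.
Qed.

Lemma dual_weight_mul alpha v : q v <= 1 ->
  dual_weight alpha * (1 + alpha (val v) ^+ 2) <= 1.
Proof. by move=> qv; rewrite -ler_pdivlMr// div1r; exact: weight_le. Qed.

Lemma dual_weight_gt0 alpha :
  seminorm_continuous q (fun v => alpha (val v)) -> 0 < dual_weight alpha.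
Proof.
move=> [C C0 hC]; apply: (@lt_le_trans _ _ (1 + C ^+ 2)^-1).
  by rewrite invr_gt0 ltr_pwDl ?sqr_ge0.
apply: lb_le_inf => // _ [v qv <-].
rewrite lef_pV2 ?posrE ?ltr_pwDl ?sqr_ge0// lerD2l.
rewrite -[leLHS]real_normK ?num_real// ler_pXn2r ?nnegrE ?(ltW C0)//.
by apply: le_trans (hC v) _; rewrite -[leRHS]mulr1 ler_wpM2l// ltW.
Qed.

Lemma dual_weight_measurable : measurable_fun setT dual_weight.
Proof.
apply: upper_semicontinuous_charSpace_measurable => c.
rewrite (_ : [set alpha | dual_weight alpha < c] =
  \bigcup_(v in [set v : subspace_type V | q v <= 1])
    [set alpha | 1 < c * (1 + alpha (val v) ^+ 2)]).
  apply: bigcup_open => v _.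
  have oc : open [set y : R | 1 < c * (1 + y ^+ 2)].
    apply: (@open_comp _ _ (fun y : R => c * (1 + y ^+ 2)) [set y | 1 < y]).
      move=> y _; apply: cvgM; first exact: cvg_cst.
      apply: cvgD; [exact: cvg_cst|exact: exprn_continuous].
    exact: open_gt.
  apply: (@open_comp _ _ (hat (val v)) _ _ oc) => alpha _.
  exact: hat_continuous.
apply/seteqP; split=> alpha /=.
  move=> /(inf_lt (bounds_ex alpha)).
  by move=> [_ [v qv <-]] h; exists v => //; rewrite /= -ltr_pdivrMr ?div1r.
move=> [v qv]; rewrite /= -ltr_pdivrMr ?div1r//.
by apply: le_lt_trans; exact: weight_le.
Qed.

(** With t = \sum alpha (e)^2, the vector v = t^(-1/2) \sum alpha (e) e has
    seminorm 1 and alpha (v)^2 = t. *)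
Lemma dual_weight_bessel alpha s : q_orthonormal_seq q s ->
  dual_weight alpha * \sum_(e <- s) alpha (val e) ^+ 2 <= 1.
Proof.
move=> os; set t := \sum_(e <- s) _.
have t0 : 0 <= t by apply: sumr_ge0 => e _; exact: sqr_ge0.
have w0 := dual_weight_ge0 alpha.
have [->|t_neq0] := eqVneq t 0; first by rewrite mulr0.
have t_gt0 : 0 < t by rewrite lt_neqAle eq_sym t_neq0.
pose u : subspace_type V := \sum_(e <- s) alpha (val e) *: e.
have au : alpha (val u) = t.
  rewrite /u linear_sum /char_fun linear_sum; apply: eq_bigr => e _.
  by rewrite !linearZ.
pose v := (Num.sqrt t)^-1 *: u.
have st0 : 0 < Num.sqrt t by rewrite sqrtr_gt0.
have qv : q v <= 1.
  rewrite -(ler_pXn2r (n := 2)) ?nnegrE ?hnorm_ge0//.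
  rewrite hnorm_scale exprMn real_normK ?num_real// orthonormal_hnorm_sum//.
  by rewrite exprVn sqr_sqrtr// mulVf// expr1n.
have := dual_weight_mul alpha qv.
have -> : alpha (val v) ^+ 2 = t.
  rewrite /v linearZ /char_fun linearZ/= -/(char_fun alpha _) au exprMn exprVn.
  by rewrite sqr_sqrtr// expr2 mulrA mulVf// mul1r.
lra.
Qed.

(** Every multiple of v may be used in the infimum. *)
Lemma dual_weight_ker alpha v : q v = 0 ->
  dual_weight alpha * alpha (val v) ^+ 2 = 0.
Proof.
move=> qv; set x := _ * _.
have x0 : 0 <= x by rewrite mulr_ge0 ?dual_weight_ge0 ?sqr_ge0.
have h t : t ^+ 2 * x <= 1.
  have qtv : q (t *: v) <= 1 by rewrite hnorm_scale qv mulr0.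
  have := dual_weight_mul alpha qtv; have := dual_weight_ge0 alpha.
  by rewrite linearZ /char_fun linearZ/= -/(char_fun alpha _) /x; lra.
apply/eqP; rewrite eq_le x0 andbT leNgt; apply/negP => x_gt0.
have := h (1 + x^-1); have : x^-1 * x = 1 by rewrite mulVf// gt_eqF.
have : 0 < x^-1 by rewrite invr_gt0.
set y := x^-1 => y0 yx.
have -> : (1 + y) ^+ 2 * x = x + 2 * (y * x) + y * (y * x) by lra.
by rewrite yx; lra.
Qed.

End dual_weight.

Section dominating_seminorm.
Context (R : realType) (A : charAlgType R) (V : submodClosed A).
Context (q : hilbertian_seminorm (subspace_type V)).
Variable nu : {measure set (charSpace A) -> \bar R}.
Hypothesis nuT : nu setT = 1%E.
Hypothesis hat_int : forall a : A, nu.-integrable setT (EFin \o hat a).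
Local Notation E := (subspace_type V).
Local Notation w := (dual_weight q).

Let g (u v : E) (alpha : charSpace A) : R :=
  w alpha * (alpha (val u) * alpha (val v)).

Let g_measurable u v : measurable_fun setT (g u v).
Proof.
apply: measurable_funM; first exact: dual_weight_measurable.
by apply: measurable_funM; exact: hat_measurable.
Qed.

Let g_int u v : nu.-integrable setT (EFin \o g u v).
Proof.
have h := hat_int (val u ^+ 2 + val v ^+ 2).
apply: (le_integrable measurableT _ _ h).
  exact/measurable_EFinP.
move=> alpha _.
change (`|g u v alpha|%:E <= `|hat (val u ^+ 2 + val v ^+ 2) alpha|%:E)%E.
rewrite lee_fin /hat /char_fun rmorphD/= !rmorphXn/= -/(char_fun alpha _).
set x := char_fun alpha _; set y := alpha _.
rewrite /g normrM [X in _ <= X]ger0_norm ?addr_ge0 ?sqr_ge0//.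
rewrite -/x -/y ger0_norm ?dual_weight_ge0//.
apply: (@le_trans _ _ `|x * y|).
  by rewrite ler_piMl// dual_weight_le1.
rewrite ler_norml; apply/andP; split.
  by have := sqr_ge0 (x + y); have := sqr_ge0 x; have := sqr_ge0 y; lra.
by have := sqr_ge0 (x - y); have := sqr_ge0 x; have := sqr_ge0 y; lra.
Qed.

Let B u v : R := (\int[nu]_alpha g u v alpha)%R.

Let B_sym u v : B u v = B v u.
Proof. by apply: eq_Rintegral => alpha _; rewrite /g [X in _ * X]mulrC. Qed.

Let B_linear v : linear_for *%R (B^~ v).
Proof.
move=> c u u'; rewrite /B -RintegralZl// -RintegralD//.
  apply: eq_Rintegral => alpha _; rewrite /g linearP/= /char_fun linearP/=.
  by lra.
exact: (integrableZl measurableT c (g_int u v)).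
Qed.

(** The square of p is a weighted second moment; [dual_weight_bessel] bounds its
    trace by the total mass of nu, and [dual_weight_ker] puts the kernel of q
    into that of p. *)
Lemma dominating_seminorm : exists p : hilbertian_seminorm E,
  (seminorm_trace p q < +oo)%E /\
  forall v, ((p v ^+ 2)%:E = \int[nu]_alpha (w alpha * alpha (val v) ^+ 2)%:E)%E.
Proof.
have B_linear2 u : linear_for *%R (B u).
  by move=> c v v'; rewrite !(B_sym u); exact: B_linear.
pose b : {biscalar E} := HB.pack B
  (bilinear_isBilinear.Build R E E R *%R *%R B (pair B_linear B_linear2)).
have b_ge0 v : 0 <= b v v.
  apply: Rintegral_ge0 => alpha _.
  by rewrite /g mulr_ge0 ?dual_weight_ge0// -expr2 sqr_ge0.
have [p pE] := hilbertian_seminorm_of_form (B_sym : forall u v, b u v = b v u) b_ge0.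
have pint v : ((p v ^+ 2)%:E = \int[nu]_alpha (w alpha * alpha (val v) ^+ 2)%:E)%E.
  rewrite pE /= /B /Rintegral fineK; last exact: integrable_fin_num (g_int v v).
  by apply: eq_integral => alpha _; rewrite /g -expr2.
exists p; split=> //; rewrite /seminorm_trace asboolT; last first.
  move=> v qv; apply/eqP; rewrite -sqrf_eq0; apply/eqP/EFin_inj; rewrite pint.
  by rewrite integral0_eq// => alpha _; rewrite dual_weight_ker.
apply: (@le_lt_trans _ _ 1%E); last exact: ltry.
apply: ge_ereal_sup => _ [F oF <-].
have os : q_orthonormal_seq q F by split; [exact: fset_uniq|exact: oF].
rewrite -sumEFin (eq_bigr (fun e => \int[nu]_alpha
  (w alpha * alpha (val e) ^+ 2)%:E)%E); last by move=> e _; exact: pint.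
have mw (e : E) : measurable_fun setT
    (fun alpha => (w alpha * alpha (val e) ^+ 2)%:E).
  apply/measurable_EFinP; apply: measurable_funM.
    exact: dual_weight_measurable.
  by apply: measurable_funX; exact: hat_measurable.
rewrite -ge0_integral_sum//; last first.
  by move=> e alpha _; rewrite lee_fin mulr_ge0 ?dual_weight_ge0 ?sqr_ge0.
rewrite -nuT -[leRHS]mul1e -integral_cst//.
apply: ge0_le_integral => //.
- move=> alpha _; apply: sume_ge0 => e _.
  by rewrite lee_fin mulr_ge0 ?dual_weight_ge0 ?sqr_ge0.
- exact: emeasurable_sum.
- move=> alpha _; rewrite sumEFin lee_fin -mulr_sumr.
  exact: dual_weight_bessel.
Qed.

End dominating_seminorm.

(** * The family of a measure *)
Section restriction.
Context (R : realType) (A : charAlgType R) (S : subalgClosed A).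

Definition char_restr (alpha : charSpace A) : charSpace (subalg_type S) :=
  char_restr_fun (S := S) alpha : {lrmorphism subalg_type S -> R | *%R}.

Lemma char_restr_continuous : continuous char_restr.
Proof.
by apply: charSpace_continuous => s; exact: (@hat_continuous R A (val s)).
Qed.

Lemma char_restr_measurable : measurable_fun setT char_restr.
Proof. exact: continuous_charSpace_measurable char_restr_continuous. Qed.

Variable nu : {measure set (charSpace A) -> \bar R}.
Hypothesis nuT : nu setT = 1%E.

Definition restr_measure : {measure set (charSpace (subalg_type S)) -> \bar R} :=
  pushforward_measure nu char_restr_measurable.

(** A compact subset of the preimage of B has compact image in B, and the
    preimage of this image is at least as large. *)
Lemma restr_measure_radon : radon nu -> radon restr_measure.
Proof.
move=> [_ inner]; split=> [beta|B mB].
  exists setT; split=> //; first exact: openT.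
  by rewrite /restr_measure /= /pushforward preimage_setT nuT ltry.
have mpre : measurable (char_restr @^-1` B).
  by rewrite -[X in measurable X]setTI; exact: char_restr_measurable.
apply/eqP; rewrite eq_le; apply/andP; split; last first.
  apply: ge_ereal_sup => _ [C [cC CB] <-]; apply: le_measure; rewrite ?inE//.
  exact: compact_charSpace_measurable.
rewrite [leLHS](inner (char_restr @^-1` B) mpre).
apply: ge_ereal_sup => _ [C [cC CB] <-].
have cD : compact (char_restr @` C).
  apply: continuous_compact => //; apply: continuous_subspaceT.
  exact: char_restr_continuous.
apply: (@le_trans _ _ (restr_measure (char_restr @` C))).
  apply: le_measure; rewrite ?inE.
  - exact: compact_charSpace_measurable.
  - rewrite -[X in measurable X]setTI; apply: char_restr_measurable => //.
    exact: compact_charSpace_measurable.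
  - by move=> x Cx; exists x.
apply: ereal_sup_ubound; exists (char_restr @` C) => //; split=> //.
by move=> _ [x Cx <-]; exact: CB.
Qed.

Lemma restr_measure_representing (L : {scalar A}) :
  representing_radon L nu ->
  representing_radon (fun s : subalg_type S => L (val s)) restr_measure.
Proof.
move=> [rad repr]; split; first exact: restr_measure_radon.
move=> s; have [int_s eq_s] := repr (val s).
have mh : measurable_fun setT (EFin \o hat s).
  by apply/measurable_EFinP; exact: hat_measurable.
split; first exact: (integrable_pushforward char_restr_measurable mh int_s).
rewrite eq_s; apply/esym.
exact: (integral_pushforward char_restr_measurable mh int_s).
Qed.

Lemma restr_measure_support (Q : set A) :
  nu (~` nonneg_chars Q) = 0%E ->
  measure_support restr_measure `<=`
    nonneg_chars [set s : subalg_type S | Q (val s)].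
Proof.
move=> nuQ beta supp; pose K := nonneg_chars [set s : subalg_type S | Q (val s)].
apply: (supp K); split; first exact: nonneg_chars_closed.
have mK : measurable (~` K).
  by apply: measurableC; apply: closed_charSpace_measurable;
    exact: nonneg_chars_closed.
apply/eqP; rewrite eq_le measure_ge0 andbT -nuQ.
change (nu (char_restr @^-1` (~` K)) <= nu (~` nonneg_chars Q))%E.
apply: le_measure; rewrite ?inE.
- by rewrite -[X in measurable X]setTI; exact: char_restr_measurable.
- by apply: measurableC; apply: closed_charSpace_measurable;
    exact: nonneg_chars_closed.
- by move=> alpha nK Qa; apply: nK => s Qs; exact: Qa.
Qed.

End restriction.

Section concentration.
Context (R : realType) (A : charAlgType R) (V : submodClosed A).
Context (p q : hilbertian_seminorm (subspace_type V)).
Variable nu : {measure set (charSpace A) -> \bar R}.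
Hypothesis nuT : nu setT = 1%E.
Local Notation w := (dual_weight q).
Hypothesis pE : forall v,
  ((p v ^+ 2)%:E = \int[nu]_alpha (w alpha * alpha (val v) ^+ 2)%:E)%E.

Let mlt c : measurable [set alpha | w alpha < c].
Proof.
rewrite -[X in measurable X]setTI -preimage_itvNyo.
by apply: dual_weight_measurable.
Qed.

(** The sets where w < 1 / n decrease to the null set where w = 0. *)
Lemma dual_weight_small_prob (M : set (charSpace A)) : measurable M ->
  nu (~` M) = 0%E -> (forall alpha, M alpha -> 0 < w alpha) ->
  forall eps, 0 < eps -> exists2 c, 0 < c &
    (nu [set alpha | (w alpha < c)%R] <= eps%:E)%E.
Proof.
move=> mM nuM wM eps eps0.
pose F n := [set alpha | w alpha < n.+1%:R^-1].
have mI : measurable (\bigcap_n F n) by apply: bigcapT_measurable => n; exact: mlt.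
have F0 : nu (\bigcap_n F n) = 0%E.
  apply/eqP; rewrite eq_le measure_ge0 andbT -nuM; apply: le_measure.
  - by rewrite inE.
  - by rewrite inE; exact: measurableC.
  move=> alpha hF /wM w0.
  have := hF (Num.truncn (w alpha)^-1) I.
  rewrite /F /= -[X in X < _]invrK ltf_pV2 ?posrE ?invr_gt0//.
  by move/lt_trans => /(_ _ (truncnS_gt _)); rewrite ltxx.
have : nu \o F @ \oo --> nu (\bigcap_n F n).
  apply: nonincreasing_cvg_mu => //.
  - rewrite (@le_lt_trans _ _ 1%E) ?ltry// -nuT.
    by apply: le_measure; rewrite ?inE//; exact: mlt.
  - by move=> n; exact: mlt.
  - move=> m n mn; apply/subsetPset => alpha /= /lt_le_trans; apply.
    by rewrite lef_pV2 ?posrE// ler_nat.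
rewrite F0 => /fine_cvgP[Ffin Fcvg].
have /cvgrPdist_lt/(_ _ eps0) h := Fcvg.
have [n [hn fn]] := filter_ex (filterI h Ffin).
exists n.+1%:R^-1 => //; change ((nu \o F) n <= eps%:E)%E.
rewrite -(fineK fn) lee_fin.
move: hn; rewrite /= sub0r normrN ger0_norm ?fine_ge0//.
exact: ltW.
Qed.

(** Where w >= c, the inequality |alpha (v)| >= 1 forces w alpha (v)^2 >= c, an
    event of measure at most a multiple of p (v)^2 / c. *)
Lemma restr_measure_concentrated (M : set (charSpace A))
    (J : set (subalgClosed A)) :
  measurable M -> nu (~` M) = 0%E -> (forall alpha, M alpha -> 0 < w alpha) ->
  concentrated p J (fun S => restr_measure S nu).
Proof.
move=> mM nuM wM eps eps0; have eps20 : 0 < eps / 2 by rewrite divr_gt0.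
have [c c0 hc] := dual_weight_small_prob mM nuM wM eps20.
have d0 : 0 < c * eps / 4 by rewrite divr_gt0// mulr_gt0.
exists (Num.sqrt (c * eps / 4)); first by rewrite sqrtr_gt0.
move=> S _ v s pv vs.
pose f alpha := w alpha * alpha (val v) ^+ 2.
have mf : measurable_fun setT f.
  apply: measurable_funM; first exact: dual_weight_measurable.
  by apply: measurable_funX; exact: hat_measurable.
have f0 alpha : 0 <= f alpha by rewrite mulr_ge0 ?dual_weight_ge0 ?sqr_ge0.
have c20 : 0 < c / 2 by rewrite divr_gt0.
have mlayer := measurable_superlevel_gt mf (c / 2).
have := layer_sum_le_integral nu mf f0 1 c20.
rewrite big_ord1 -pE mul1r => markov.
have {}markov : (nu [set alpha | (c / 2 < f alpha)%R] <= (eps / 2)%:E)%E.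
  rewrite -(@lee_pmul2l _ (c / 2)%:E)//; apply: le_trans markov _.
  rewrite -EFinM lee_fin.
  have : p v ^+ 2 <= c * eps / 4.
    rewrite -[leRHS]sqr_sqrtr ?(ltW d0)// ler_pXn2r ?nnegrE ?hnorm_ge0 ?sqrtr_ge0//.
  lra.
change (nu (@char_restr _ _ S @^-1` [set beta | (1 <= `|beta s|)%R]) <= eps%:E)%E.
apply: (@le_trans _ _ (nu ([set alpha | w alpha < c] `|` [set alpha | c / 2 < f alpha]))).
  apply: le_measure; rewrite ?inE.
  - rewrite -[X in measurable X]setTI; apply: char_restr_measurable => //.
    exact: measurable_hat_norm_ge.
  - exact: measurableU.
  move=> alpha; rewrite /preimage /= => h.
  have [?|wc] := ltP (w alpha) c; [by left|right].
  have h1 : 1 <= alpha (val v) ^+ 2.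
    rewrite -[leRHS]real_normK ?num_real// exprn_ege1// vs; exact: h.
  rewrite /f; apply: (@lt_le_trans _ _ c); first lra.
  by rewrite -[leLHS]mulr1 ler_pM// ltW.
apply: le_trans (measureU2 _ (mlt c) mlayer) _.
by rewrite (_ : eps = eps / 2 + eps / 2) ?EFinD ?leeD//; lra.
Qed.

End concentration.

Theorem theorem2p8 (R : realType) (A : charAlgType R) (V : submodClosed A)
    (K : set (charSpace A)) (q : hilbertian_seminorm (subspace_type V))
    (L : {scalar A}) (Q : set A) :
  generated_by V ->
  closed K ->
  continuous_chars K q !=set0 ->
  L 1 = 1 ->
  quadratic_module Q ->
  K = nonneg_chars Q ->
  ((exists nu : {measure set (charSpace A) -> \bar R},
      representing_radon L nu /\ nu (~` continuous_chars K q) = 0%E)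
   <->
   (exists p : hilbertian_seminorm (subspace_type V),
      (seminorm_trace p q < +oo)%E /\
      exists nu : forall S : subalgClosed A,
          {measure set (charSpace (subalg_type S)) -> \bar R},
        (forall S, fin_gen_subalgs V S ->
           representing_radon (fun s : subalg_type S => L (val s)) (nu S) /\
           measure_support (nu S) `<=`
             nonneg_chars [set s : subalg_type S | Q (val s)]) /\
        concentrated p (fin_gen_subalgs V) nu)).
Proof.
move=> genV cK _ L1 _ KQ; split; last first.
  move=> [p [tr [nu [repr conc]]]]; rewrite KQ.
  exact: (measure_of_concentrated_family genV L1 tr repr conc).
move=> [nu [repr nuM]]; have nuT := representing_radon_total repr L1.
have mM : measurable (continuous_chars K q).
  rewrite KQ continuous_charsE; apply: bigcupT_measurable => k.
  by apply: closed_charSpace_measurable; exact: dual_ball_closed.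
have [p [tr pE]] := dominating_seminorm q nuT (fun a => (repr.2 a).1).
exists p; split=> //; exists (fun S => restr_measure S nu); split.
  move=> S _; split; first exact: restr_measure_representing.
  apply: restr_measure_support; apply/eqP; rewrite eq_le measure_ge0 andbT.
  rewrite -KQ -nuM; apply: le_measure; rewrite ?inE.
  - by apply: measurableC; exact: closed_charSpace_measurable.
  - exact: measurableC.
  - by move=> alpha nK [].
apply: (@restr_measure_concentrated _ _ _ _ _ _ nuT pE _ _ mM nuM) => alpha [_].
exact: dual_weight_gt0.
Qed.
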